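(* Let $\gamma_u:[a,\tau]\to\overline{Q}_1$ be an incident trajectory and $\gamma_w:[\tau,b]\to\overline{Q}_1$ an associated reflected trajectory, such that the concatenation $\gamma_u\cup\gamma_w$ is transverse to $\eta$ (this is the situation in which, with $p=\gamma_u(\tau)$, $T_p\eta$ is $\mathcal{C}^1$-timelike and $\Pi^1_u$ is $\mathcal{C}^1$-spacelike). Then $\gamma_u\cup\gamma_w$ is not a Snell cone geodesic.
   Context: All manifolds are smooth; hypersurfaces are smooth and embedded. Cone structures. A cone structure on a manifold $Q$ is a hypersurface $\mathcal{C}$ of $TQ\setminus\mathbf{0}$ such that for each $p\in Q$: (i) $\mathcal{C}$ is transverse to the fibers of $TQ$, i.e. for $v\in\mathcal{C}_p:=T_pQ\cap\mathcal{C}$, $T_v(T_pQ)+T_{(p,v)}\mathcal{C}=T_{(p,v)}(TQ)$; (ii) $\mathcal{C}_p$ is conic ($v\in\mathcal{C}_p\Rightarrow\lambda v\in\mathcal{C}_p$ for all $\lambda>0$), salient ($v\in\mathcal{C}_p\Rightarrow -v\notin\mathcal{C}_p$), is the boundary in $T_pQ\setminus\{0\}$ of an open convex subset $A_p\subset T_pQ\setminus\{0\}$, and is (non-radially) strongly convex: the second fundamental form of $\mathcal{C}_p$ as an affine hypersurface of $T_pQ$ is positive semi-definite (with respect to an inner direction pointing to $A_p$) with radical at each $v\in\mathcal{C}_p$ spanned by the radial direction of $v$. A vector $v\in T_pQ$ is timelike if $v\in A_p$, lightlike if $v\in\mathcal{C}_p$, causal if $v\in A_p\cup\mathcal{C}_p$,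 spacelike if neither $v$ nor $-v$ is causal; a linear subspace is timelike if it contains a timelike vector, spacelike if all its vectors are spacelike; a piecewise smooth curve is timelike/lightlike/causal if its (one-sided) velocities are so everywhere. For $v\in\mathcal{C}_p$, $v^{\perp_{\mathcal{C}}}:=T_v\mathcal{C}_p$, a hyperplane of $T_pQ$. For one cone structure $\mathcal{C}$: $I^+(p)$ is the set of $q$ reached from $p$ by a timelike curve; $J^+(p)$ is the set of $q$ equal to $p$ or reached from $p$ by a causal curve; $p\to q$ means $q\in J^+(p)\setminus I^+(p)$; a subscript $\Omega$ ($\Omega$ open) means that only curves contained in $\Omega$ are used. A continuous curve $\gamma:I\to Q$ is locally horismotic if for each $t_0\in I$ there are an open neighborhood $\Omega$ of $\gamma(t_0)$ and $\varepsilon>0$ such that, with $I_\varepsilon:=[t_0-\varepsilon,t_0+\varepsilon]\cap I$, $\gamma(I_\varepsilon)\subset\Omega$ and $t_1<t_2\Leftrightarrow\gamma(t_1)\to_\Omega\gamma(t_2)$ for all $t_1,t_2\in I_\varepsilon$. A cone geodesic of $\mathcal{C}$ is a locally horismotic curve (equivalently, a lightlike pregeodesic of any Lorentz–Finsler metric with lightcone $\mathcal{C}$). Setting. $Q$ is a manifold of dimension $n+1\ge3$; $\eta$ is a hypersurface dividing $Q$ into two open subsets $Q_1,Q_2$ whose closures $\overline{Q}_1,\overline{Q}_2$ (with union $Q$) are smooth manifolds with common boundary $\eta$. $\mathcal{C}^1,\mathcal{C}^2$ are cone structures on $\overline{Q}_1,\overline{Q}_2$ (smoothly extendable slightly beyond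 $\eta$), not necessarily matching on $\eta$. Directions and trajectories. For $p\in\eta$, $Q^\mu_p\subset T_pQ$ is the open half-space of $T_pQ\setminus T_p\eta$ on the $Q_\mu$-side. For $r\in\mathcal{C}^1_p$ put $\Pi^1_r:=r^{\perp_{\mathcal{C}^1}}\cap T_p\eta$. An incident direction is $u\in\mathcal{C}^1_p$ with $u\in Q^2_p\cup T_p\eta$. A reflected direction associated with $u$ is $w\in\mathcal{C}^1_p$ with $w\in Q^1_p\cup T_p\eta$ and $\Pi^1_u\subset\Pi^1_w$. A curve is topologically transverse to $\eta$ if it meets $\eta$ exactly once, and transverse to $\eta$ if in addition its one-sided velocities at that point are not in the tangent space of $\eta$. An incident trajectory $\gamma_u:[a,\tau]\to\overline{Q}_1$ is a cone geodesic of $\mathcal{C}^1$ topologically transverse to $\eta$, with $\gamma_u(\tau)\in\eta$, such that $u=\dot\gamma_u(\tau^-)$ is an incident direction. An associated reflected trajectory $\gamma_w:[\tau,b]\to\overline{Q}_1$ is a cone geodesic of $\mathcal{C}^1$ topologically transverse to $\eta$, with $\gamma_w(\tau)=\gamma_u(\tau)\in\eta$, such that $w=\dot\gamma_w(\tau^+)$ is a reflected direction associated with $u$. $\gamma_u\cup\gamma_w$ denotes the concatenation. Extended causality on $(Q,\mathcal{C}^1\cup\mathcal{C}^2)$. A piecewise smooth curve $\gamma:[a,b]\to Q$ topologically transverse to $\eta$, with $\gamma(\tau)\in\eta$, $\gamma([a,\tau))\subset Q_\mu$, $\gamma((\tau,b])\subset Q_\nu$ ($\mu,\nu\in\{1,2\}$),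 is timelike (lightlike, causal) if $\gamma|_{[a,\tau]}$ and $\gamma|_{[\tau,b]}$ are so for $\mathcal{C}^\mu$ and $\mathcal{C}^\nu$, respectively. Using these curves together with the usual $\mathcal{C}^\mu$-timelike/causal curves contained in $\overline{Q}_\mu$ that meet $\eta$ at most once, one defines $I^\pm$, $J^\pm$, $I^\pm_\Omega$, $J^\pm_\Omega$ and $\to_\Omega$ on $Q$ as for one cone structure. A Snell cone geodesic is a continuous curve $\gamma:I\to Q$ which is locally horismotic with respect to these extended relations. *)

(* Defs.v *)
From HB Require Import structures.
From mathcomp Require Import all_boot all_order all_algebra.
From mathcomp Require Import all_classical all_reals all_analysis.

Set Implicit Arguments.
Unset Strict Implicit.
Unset Printing Implicit Defensive.

Import Order.TTheory GRing.Theory Num.Theory.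
Import numFieldNormedType.Exports.

Local Open Scope classical_set_scope.
Local Open Scope ring_scope.

(* [U] is open and [E] finite-dimensional in every use, so that continuity of
   all directional derivatives amounts to continuity of the differential. *)
Fixpoint of_class {R : realType} {E F : normedModType R} (k : nat)
    (U : set E) (f : E -> F) : Prop :=
  match k with
  | 0%N => forall x, U x -> {for x, continuous f}
  | k'.+1 => (forall x, U x -> differentiable f x) /\
             forall v, of_class k' U ('D_v f)
  end.

Definition smooth {R : realType} {E F : normedModType R} (U : set E)
    (f : E -> F) : Prop := forall k, of_class k U f.

Definition local_defining {R : realType} {E : normedModType R} (S : set E)
    (x : E) (W : set E) (F : E -> R) : Prop :=
  [/\ open W, W x, smooth W F, (exists z, 'd F x z != 0) &
      forall y, W y -> (S y <-> F y = 0)].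

Definition hypersurface_at {R : realType} {E : normedModType R} (S : set E)
    (x : E) : Prop := exists W F, local_defining S x W F.

(* T_x S, for a hypersurface S and x in S; the kernel of the differential does
   not depend on the local defining function. *)
Definition tangent_space {R : realType} {E : normedModType R} (S : set E)
    (x : E) : set E :=
  [set z | forall W F, local_defining S x W F -> 'd F x z = 0].

(* Coefficient of xi in the normal part of D_X Y, for a hypersurface F = 0 and
   a transverse vector xi: differentiating 'd F (Y) = 0 along X gives
   D_X D_Y F + 'd F (D_X Y) = 0. *)
Definition second_form {R : realType} {E : normedModType R} (F : E -> R)
    (xi v X Y : E) : R := - 'D_X ('D_Y F) v / 'd F v xi.

(* A smooth manifold of dimension n + 1, with an atlas consisting of one chart
   [chart p] around each point [p]; every smooth structure contains such an
   atlas. *)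
Record manifold (R : realType) (n : nat) := Manifold {
  mcarrier :> topologicalType;
  dom : mcarrier -> set mcarrier;
  chart : mcarrier -> mcarrier -> 'rV[R]_n.+1;
  chart_inv : mcarrier -> 'rV[R]_n.+1 -> mcarrier;
  _ : hausdorff_space mcarrier;
  _ : @second_countable mcarrier;
  _ : forall p, open (dom p);
  _ : forall p, dom p p;
  _ : forall p, open (chart p @` dom p);
  _ : forall p q, dom p q -> chart_inv p (chart p q) = q;
  _ : forall p q, dom p q -> {for q, continuous (chart p)};
  _ : forall p y, (chart p @` dom p) y -> {for y, continuous (chart_inv p)};
  _ : forall p q, smooth (chart p @` (dom p `&` dom q))
                         (chart q \o chart_inv p) }.

(* The tangent space T_p M is 'rV[R]_n.+1, read through the chart [chart p].
   A pair (p, v) in M * 'rV[R]_n.+1 is thus a point of TM, and [tchart p] is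
   the chart of TM over [dom p]. *)
Definition tchart {R : realType} {n : nat} {M : manifold R n} (p : M)
    (z : M * 'rV[R]_n.+1) : ('rV[R]_n.+1 * 'rV[R]_n.+1)%type :=
  (chart p z.1, 'd (chart p \o chart_inv z.1) (chart z.1 z.1) z.2).

Definition in_chart {R : realType} {n : nat} {M : manifold R n} (p : M)
    (S : set M) : set 'rV[R]_n.+1 := chart p @` (S `&` dom p).

Definition hypersurface {R : realType} {n : nat} {M : manifold R n}
    (S : set M) : Prop :=
  forall p, S p -> hypersurface_at (in_chart p S) (chart p p).

Definition tangent_at {R : realType} {n : nat} {M : manifold R n}
    (S : set M) (p : M) : set 'rV[R]_n.+1 :=
  tangent_space (in_chart p S) (chart p p).

(* [lightlike p] and [timelike p] are the subsets C_p and A_p of T_p M; the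
   convex set A_p is determined by its boundary C_p. *)
Record cone {R : realType} {n : nat} (M : manifold R n) := Cone {
  lightlike : M -> set 'rV[R]_n.+1;
  timelike : M -> set 'rV[R]_n.+1 }.

Definition causal {R : realType} {n : nat} {M : manifold R n} (K : cone M)
    (p : M) : set 'rV[R]_n.+1 := timelike K p `|` lightlike K p.

(* xi is an inner transverse direction at v, and the radical is spanned by v.
   Neither clause depends on the choice of F and xi. *)
Definition strongly_convex {R : realType} {V : normedModType R}
    (C A : set V) : Prop :=
  forall v, C v -> exists W F xi,
    [/\ local_defining C v W F,
        ~ tangent_space C v xi,
        (\forall t \near (0 : R)^'+, A (v + t *: xi)),
        (forall X, tangent_space C v X -> 0 <= second_form F xi v X X) &
        (forall X, tangent_space C v X ->
          ((forall Y, tangent_space C v Y -> second_form F xi v X Y = 0) <->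
           exists l : R, X = l *: v))].

Definition cone_structure {R : realType} {n : nat} {M : manifold R n}
    (O : set M) (K : cone M) : Prop :=
  forall p, O p ->
    let C := lightlike K p in
    let A := timelike K p in
    let TC := tchart p @`
      [set z | [/\ O z.1, dom p z.1 & lightlike K z.1 z.2]] in
    [/\ (forall v, C v -> hypersurface_at TC (tchart p (p, v))),
        (forall v, C v -> forall z : 'rV[R]_n.+1 * 'rV[R]_n.+1,
           exists y : 'rV[R]_n.+1,
             tangent_space TC (tchart p (p, v)) (z - (0, y))),
        (forall v, C v -> forall l : R, 0 < l -> C (l *: v)) /\
        (forall v, C v -> ~ C (- v)),
        [/\ open A, ~ A 0,
            (forall v w, A v -> A w -> forall t : R, 0 <= t <= 1 ->
               A (t *: v + (1 - t) *: w)) &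
            C = (closure A `\` interior A) `\ 0] &
        strongly_convex C A].

(* Cone structures on the closure of U which extend smoothly beyond it. *)
Definition cone_structure_on_closure {R : realType} {n : nat}
    {M : manifold R n} (U : set M) (K : cone M) : Prop :=
  exists O K', [/\ open O, closure U `<=` O, cone_structure O K' &
    forall p, closure U p ->
      lightlike K p = lightlike K' p /\ timelike K p = timelike K' p].

(* A curve with domain [a, b] is a function on R of which only the values on
   [a, b] are used. *)

Definition smooth_arc {R : realType} {n : nat} {M : manifold R n}
    (g : R -> M) (c d : R) : Prop :=
  forall t, c <= t <= d -> exists (f : R -> 'rV[R]_n.+1) (e : R),
    [/\ 0 < e, smooth (ball t e) f &
        forall s, c <= s <= d -> ball t e s ->
          dom (g t) (g s) /\ chart (g t) (g s) = f s].

Definition piecewise_smooth {R : realType} {n : nat} {M : manifold R n}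
    (g : R -> M) (a b : R) : Prop :=
  exists s : seq R, [/\ path <%R a s, last a s = b &
    forall k, (k < size s)%N -> smooth_arc g (nth a (a :: s) k) (nth a s k)].

Definition right_velocity {R : realType} {n : nat} {M : manifold R n}
    (g : R -> M) (t : R) (X : 'rV[R]_n.+1) : Prop :=
  h^-1 *: (chart (g t) (g (t + h)) - chart (g t) (g t)) @[h --> (0 : R)^'+]
    --> X.

Definition left_velocity {R : realType} {n : nat} {M : manifold R n}
    (g : R -> M) (t : R) (X : 'rV[R]_n.+1) : Prop :=
  h^-1 *: (chart (g t) (g (t + h)) - chart (g t) (g t)) @[h --> (0 : R)^'-]
    --> X.

Definition curve_of_type {R : realType} {n : nat} {M : manifold R n}
    (K : M -> set 'rV[R]_n.+1) (g : R -> M) (a b : R) : Prop :=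
  [/\ a < b, piecewise_smooth g a b,
      (forall t, a <= t < b -> exists2 X, right_velocity g t X & K (g t) X) &
      (forall t, a < t <= b -> exists2 X, left_velocity g t X & K (g t) X)].

Definition reached {R : realType} {M : topologicalType}
    (T : (R -> M) -> R -> R -> Prop) (Omega : set M) (p q : M) : Prop :=
  exists g a b, [/\ T g a b, g a = p, g b = q &
    forall t, a <= t <= b -> Omega (g t)].

(* The relation p -> q, when T and J are the families of timelike and
   causal curves. *)
Definition horismos {R : realType} {M : topologicalType}
    (T J : (R -> M) -> R -> R -> Prop) (Omega : set M) (p q : M) : Prop :=
  (p = q \/ reached J Omega p q) /\ ~ reached T Omega p q.

(* The equivalence concerns distinct parameters: without timelike loops p -> p
   always holds. *)
Definition locally_horismotic {R : realType} {M : topologicalType}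
    (T J : (R -> M) -> R -> R -> Prop) (g : R -> M) (a b : R) : Prop :=
  {within `[a, b], continuous g} /\
  forall t0, a <= t0 <= b -> exists (Omega : set M) (e : R),
    let I := [set t | a <= t <= b /\ t0 - e <= t <= t0 + e] in
    [/\ open Omega, Omega (g t0), 0 < e, (forall t, I t -> Omega (g t)) &
        forall t1 t2, I t1 -> I t2 -> t1 != t2 ->
          (t1 < t2 <-> horismos T J Omega (g t1) (g t2))].

Definition curve_in_closure {R : realType} {n : nat} {M : manifold R n}
    (U : set M) (K : M -> set 'rV[R]_n.+1) (g : R -> M) (a b : R) : Prop :=
  curve_of_type K g a b /\ forall t, a <= t <= b -> closure U (g t).

Definition cone_geodesic {R : realType} {n : nat} {M : manifold R n}
    (U : set M) (K : cone M) (g : R -> M) (a b : R) : Prop :=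
  (forall t, a <= t <= b -> closure U (g t)) /\
  locally_horismotic (curve_in_closure U (timelike K))
                     (curve_in_closure U (causal K)) g a b.

Inductive side := side1 | side2.

(* Such an F exhibits the closure of U as a manifold with boundary eta near
   p. *)
Definition boundary_defining {R : realType} {n : nat} {M : manifold R n}
    (eta U : set M) (p : M) (W : set 'rV[R]_n.+1) (F : 'rV[R]_n.+1 -> R) :=
  local_defining (in_chart p eta) (chart p p) W F /\
  forall y, W y -> (in_chart p U y <-> 0 < F y).

Definition divides {R : realType} {n : nat} {M : manifold R n}
    (eta : set M) (Qs : side -> set M) : Prop :=
  [/\ hypersurface eta, (forall mu, open (Qs mu)),
      Qs side1 `&` Qs side2 = set0,
      Qs side1 `|` Qs side2 = ~` eta &
      forall mu p, eta p -> exists W F, boundary_defining eta (Qs mu) p W F].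

(* The open half-space of the vectors at p in eta pointing strictly into U. *)
Definition half_space {R : realType} {n : nat} {M : manifold R n}
    (eta U : set M) (p : M) : set 'rV[R]_n.+1 :=
  [set X | forall W F, boundary_defining eta U p W F ->
     0 < 'd F (chart p p) X].

Definition topologically_transverse {R : realType} {M : topologicalType}
    (eta : set M) (g : R -> M) (a b : R) : Prop :=
  exists! t, a <= t <= b /\ eta (g t).

Definition transverse {R : realType} {n : nat} {M : manifold R n}
    (eta : set M) (g : R -> M) (a b : R) : Prop :=
  topologically_transverse eta g a b /\
  forall t, a <= t <= b -> eta (g t) ->
    (a < t ->
       exists2 X, left_velocity g t X & ~ tangent_at eta (g t) X) /\
    (t < b ->
       exists2 X, right_velocity g t X & ~ tangent_at eta (g t) X).

Definition incident_direction {R : realType} {n : nat} {M : manifold R n}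
    (eta : set M) (Qs : side -> set M) (Cs : side -> cone M) (p : M)
    (u : 'rV[R]_n.+1) : Prop :=
  lightlike (Cs side1) p u /\
  (half_space eta (Qs side2) p u \/ tangent_at eta p u).

Definition Pi1 {R : realType} {n : nat} {M : manifold R n}
    (eta : set M) (Cs : side -> cone M) (p : M) (r : 'rV[R]_n.+1) :
    set 'rV[R]_n.+1 :=
  tangent_space (lightlike (Cs side1) p) r `&` tangent_at eta p.

Definition reflected_direction {R : realType} {n : nat} {M : manifold R n}
    (eta : set M) (Qs : side -> set M) (Cs : side -> cone M) (p : M)
    (u w : 'rV[R]_n.+1) : Prop :=
  [/\ lightlike (Cs side1) p w,
      half_space eta (Qs side1) p w \/ tangent_at eta p w &
      Pi1 eta Cs p u `<=` Pi1 eta Cs p w].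

Definition incident_trajectory {R : realType} {n : nat} {M : manifold R n}
    (eta : set M) (Qs : side -> set M) (Cs : side -> cone M)
    (a tau : R) (gu : R -> M) (u : 'rV[R]_n.+1) : Prop :=
  [/\ a < tau, cone_geodesic (Qs side1) (Cs side1) gu a tau,
      topologically_transverse eta gu a tau /\ eta (gu tau),
      left_velocity gu tau u &
      incident_direction eta Qs Cs (gu tau) u].

Definition reflected_trajectory {R : realType} {n : nat} {M : manifold R n}
    (eta : set M) (Qs : side -> set M) (Cs : side -> cone M)
    (tau b : R) (gu : R -> M) (u : 'rV[R]_n.+1)
    (gw : R -> M) (w : 'rV[R]_n.+1) : Prop :=
  [/\ tau < b, cone_geodesic (Qs side1) (Cs side1) gw tau b,
      topologically_transverse eta gw tau b /\ gw tau = gu tau,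
      right_velocity gw tau w &
      reflected_direction eta Qs Cs (gw tau) u w].

Definition concatenation {R : realType} {M : Type} (tau : R) (g h : R -> M) :
    R -> M := fun t => if t <= tau then g t else h t.

(* The cases tau = a and tau = b of curves meeting eta at tau are covered by
   the first alternative. *)
Definition extended_curve {R : realType} {n : nat} {M : manifold R n}
    (eta : set M) (Qs : side -> set M) (K : side -> M -> set 'rV[R]_n.+1)
    (g : R -> M) (a b : R) : Prop :=
  (exists mu, curve_in_closure (Qs mu) (K mu) g a b /\
     forall s t, a <= s <= b -> a <= t <= b -> eta (g s) -> eta (g t) ->
       s = t) \/
  (exists mu nu tau,
     [/\ a < tau < b, eta (g tau),
         (forall t, a <= t < tau -> Qs mu (g t)),
         (forall t, tau < t <= b -> Qs nu (g t)) &
         curve_of_type (K mu) g a tau /\ curve_of_type (K nu) g tau b]).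

Definition snell_cone_geodesic {R : realType} {n : nat} {M : manifold R n}
    (eta : set M) (Qs : side -> set M) (Cs : side -> cone M)
    (g : R -> M) (a b : R) : Prop :=
  locally_horismotic
    (extended_curve eta Qs (fun mu => timelike (Cs mu)))
    (extended_curve eta Qs (fun mu => causal (Cs mu))) g a b.

(* Main.v *)
Require Import Defs.
From HB Require Import structures.
From mathcomp Require Import all_boot all_order all_algebra.
From mathcomp Require Import all_classical all_reals all_analysis.
From mathcomp Require Import ring lra.

Import Order.TTheory GRing.Theory Num.Theory.
Import numFieldNormedType.Exports.

Local Open Scope classical_set_scope.
Local Open Scope ring_scope.

(* Let [p] be the reflection point. By transversality [u] points out of [Q_1]
   and [w] into it, so they are not proportional and strong convexity makes
   [m = (u + w) / 2] timelike at [p]. In the chart at [p], the segment from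
   [gamma_u (tau - e)] to [gamma_w (tau + e)], run through in time [2 e], has a
   velocity tending to [m] and stays in [Q_1] for small [e]. Timelikeness being
   an open condition on the tangent bundle, this shortcut is timelike, so the two
   points are not horismotically related. *)

(** [cone_structure] makes the bundle of lightlike vectors a hypersurface, but ties [timelike] to it
    only fibre by fibre, through a boundary condition. Openness of timelikeness in the tangent
    bundle must therefore be extracted from the light cones: transversality makes nearby cones meet
    a fixed direction near [u] and near [w], and convexity of each nearby fibre fills in between.
    Likewise strong convexity is infinitesimal, a condition on the second fundamental form at single
    points; to compare the distant vectors [u] and [w], a tangent hyperplane is propagated along a
    whole segment. First-order expansions and the intermediate value theorem do the work of the
    implicit function theorem. Velocities are read in the chart at the moving point, so a straight
    line in the chart at [p] has its velocity transported by differentials of transition maps. *)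

Lemma nbhs_dist (R : realType) (E : normedModType R) (x : E) (P : set E) :
  nbhs x P <-> exists2 d : R, 0 < d & forall y, `|y - x| < d -> P y.
Proof.
split=> [/nbhs_ballP[d d0 h]|[d d0 h]].
  exists d => // y yx; apply: h.
  by rewrite -ball_normE /= distrC.
apply/nbhs_ballP; exists d => // y.
by rewrite -ball_normE /= distrC => /h.
Qed.

Lemma closure_dist (R : realType) (E : normedModType R) (A : set E) (x : E) :
  closure A x <-> forall d : R, 0 < d -> exists2 y, A y & `|y - x| < d.
Proof.
split=> [h d d0|h B /nbhs_dist[d d0 dB]].
  have [|y [Ay dy]] := h [set y | `|y - x| < d].
    by apply/nbhs_dist; exists d.
  by exists y.
by have [y Ay /dB By] := h d d0; exists y.
Qed.

(** Frechet differentiability makes the error uniform over bounded directions [Z]. This matters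
    because the secant directions used later vary with the step [s]. *)
Lemma ray_bound (R : realType) (E : normedModType R) (F : E -> R) (v : E) :
  differentiable F v -> forall M e : R, 0 < e -> exists2 d : R, 0 < d &
  forall (s : R) (Z : E), 0 < s < d -> `|Z| <= M ->
    `|F (v + s *: Z) - F v - s * 'd F v Z| <= e * s.
Proof.
move=> /diff_locally /eqaddoP h M e e0.
pose M1 := `|M| + 1.
have M1_gt0 : 0 < M1 by rewrite ltr_wpDl.
have := h (e / M1) (divr_gt0 e0 M1_gt0).
move=> /nbhs_dist[d d0 hd].
exists (d / M1) => [|s Z /andP[s0 sd] ZM]; first exact: divr_gt0.
have ZM1 : `|Z| <= M1 by rewrite (le_trans ZM)// /M1 (le_trans (ler_norm M))// lerDl.
have nsZ : `|s *: Z| <= s * M1.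
  by rewrite normrZ gtr0_norm// ler_pM2l.
have := hd (s *: Z); rewrite subr0 => hd1.
have {hd1} := hd1 _; move=> /(_ _)/wrap[].
  by rewrite (le_lt_trans nsZ)// -ltr_pdivlMr.
rewrite !fctE /= linearZ /= [s *: Z + v]addrC opprD addrA => H.
apply: (le_trans H); apply: (le_trans (ler_wpM2l _ nsZ)); first exact/ltW/divr_gt0.
by rewrite mulrCA divfK ?gt_eqF// mulrC.
Qed.

(** The linear term is at least [c * s], and the error is kept below half of it. Applied to [- F],
    it gives negativity. *)
Lemma ray_pos (R : realType) (E : normedModType R) (F : E -> R) (v : E) (M c : R) :
  differentiable F v -> F v = 0 -> 0 < c -> exists2 d : R, 0 < d &
  forall (s : R) (Z : E), 0 < s < d -> `|Z| <= M -> c <= 'd F v Z -> 0 < F (v + s *: Z).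
Proof.
move=> dF F0 c0; have c2 : 0 < c / 2 by rewrite divr_gt0.
have [d d0 h] := ray_bound _ _ _ _ dF M _ c2.
exists d => // s Z sd ZM cZ; have := h s Z sd ZM.
have /andP[s0 _] := sd.
rewrite F0 subr0 ler_norml => /andP[h1 _].
nra.
Qed.

(** * Lines, intermediate values and Lagrange multipliers *)

Lemma near_translate (R : realType) (E : normedModType R) (z c : E) (P : set E) :
  nbhs (z + c) P -> \forall z' \near z, P (z' + c).
Proof.
have h : {for z, continuous (fun z' : E => z' + c)}.
  by apply: cvgD; [exact: cvg_id|exact: cvg_cst].
by move=> /h.
Qed.

Lemma line_continuous (R : realType) (E : normedModType R) (x z : E) :
  continuous (fun t : R => x + t *: z).
Proof.
by move=> t; apply: cvgD; [exact: cvg_cst|apply: cvgZr_tmp; exact: cvg_id].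
Qed.

Lemma line_IVT (R : realType) (E : normedModType R) (F : E -> R) (x z : E)
    (a b : R) : a <= b ->
  (forall t, a <= t <= b -> {for x + t *: z, continuous F}) ->
  F (x + a *: z) * F (x + b *: z) <= 0 ->
  exists2 t, a <= t <= b & F (x + t *: z) = 0.
Proof.
move=> ab cF h.
have [||t] := @IVT R (fun t => F (x + t *: z)) a b 0 ab.
- apply: continuous_in_subspaceT => t /set_mem /=; rewrite in_itv /= => tab.
  apply: (@continuous_comp _ _ _ (fun t : R => x + t *: z) F).
    exact: line_continuous.
  exact: cF.
- rewrite ge_min le_max; apply/andP; split; apply/orP.
    by case: (lerP (F (x + a *: z)) 0) => Fa; [left|right]; nra.
  by case: (lerP 0 (F (x + a *: z))) => Fa; [left|right]; nra.
- by rewrite in_itv /= => tab Ft; exists t.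
Qed.

Lemma ball_line (R : realType) (E : normedModType R) (x y z : E) (r a b t : R) :
  `|y + a *: z - x| < r -> `|y + b *: z - x| < r -> a <= t <= b ->
  `|y + t *: z - x| < r.
Proof.
move=> ar br /andP[at_ tb].
have [ab|] := ltrP a b; last first.
  move=> ba; suff -> : t = a by [].
  by apply/eqP; rewrite eq_le at_ (le_trans tb).
pose l := (b - t) / (b - a).
have ba0 : 0 < b - a by rewrite subr_gt0.
have l0 : 0 <= l by rewrite divr_ge0 ?subr_ge0 // ltW.
have l1 : 0 <= 1 - l.
  by rewrite subr_ge0 ler_pdivrMr// mul1r lerD2l lerN2.
have -> : y + t *: z - x = l *: (y + a *: z - x) + (1 - l) *: (y + b *: z - x).
  rewrite !(addrAC _ _ (- x)); move: (y - x) => c.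
  rewrite !scalerDr addrACA -scalerDl [l + _]addrC subrK scale1r.
  rewrite !scalerA -scalerDl; congr (_ + _ *: _).
  by rewrite /l; field; rewrite gt_eqF.
clearbody l; apply: (le_lt_trans (ler_normD _ _)).
rewrite !normrZ !ger0_norm//.
have [l10|l10] := ltrP 0 l.
  have -> : r = l * r + (1 - l) * r by ring.
  by apply: ltr_leD; rewrite ?ltr_pM2l ?ler_wpM2l// ltW.
have -> : l = 0 by apply/le_anti; rewrite l10.
by rewrite mul0r add0r subr0 mul1r.
Qed.

(* Lagrange multipliers. As [F] is only differentiable at [v], the zeros of [F]
   near [v + s *: Y] come from the intermediate value theorem. *)
Lemma diff_zero_set (R : realType) (E : normedModType R) (F G : E -> R)
    (v xi Y : E) :
  (\forall y \near v, {for y, continuous F}) ->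
  differentiable F v -> F v = 0 -> 'd F v xi != 0 -> 'd F v Y = 0 ->
  differentiable G v -> G v = 0 -> (\forall y \near v, F y = 0 -> 0 <= G y) ->
  'd G v Y = 0.
Proof.
move=> + dF Fv Fxi FY dG Gv.
wlog Fxi0 : xi Fxi / 0 < 'd F v xi => [H|].
  have [?|?|] := ltrgt0P ('d F v xi); first exact: H Fxi _.
    by apply: (H (- xi)); rewrite linearN/= ?oppr_eq0// oppr_gt0.
  by move=> h; rewrite h eqxx in Fxi.
move=> /nbhs_dist[r1 r10 cF] /nbhs_dist[r2 r20 G0].
(* The kernel of ['d F v] is symmetric, so the inequality for both [Y] and [- Y] gives the
   equality. *)
suff main Y' : 'd F v Y' = 0 -> 0 <= 'd G v Y'.
  apply/le_anti; rewrite main// andbT.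
  by rewrite -oppr_ge0 -linearN main// linearN/= FY oppr0.
move=> {}FY; rewrite leNgt; apply/negP => GY.
pose g := - 'd G v Y'.
have g0 : 0 < g by rewrite oppr_gt0.
(* Adding [t *: xi] with [|t| <= del] to [Y'] changes ['d G v] by at most [g / 2], so it stays below
   [- g / 2]. *)
pose del := g / (2 * (`|'d G v xi| + 1)).
have N0 : 0 < `|'d G v xi| + 1 by rewrite ltr_wpDl.
have del0 : 0 < del by rewrite divr_gt0 // mulr_gt0.
pose M := `|Y'| + del * `|xi|.
have Mle (t : R) : - del <= t <= del -> `|Y' + t *: xi| <= M.
  move=> td; rewrite (le_trans (ler_normD _ _))// lerD2l normrZ ler_wpM2r//.
  by rewrite ler_norml.
have c0 : 0 < del * 'd F v xi by rewrite mulr_gt0.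
have [d1 d10 h1] := @ray_pos _ _ F v M _ dF Fv c0.
have dNF : differentiable (- F) v by exact: differentiableN.
have NFv : (- F) v = 0 by rewrite fctE Fv oppr0.
have [d2 d20 h2] := @ray_pos _ _ _ v M _ dNF NFv c0.
have dNG : differentiable (- G) v by exact: differentiableN.
have NGv : (- G) v = 0 by rewrite fctE Gv oppr0.
have [d3 d30 h3] := @ray_pos _ _ _ v M (g / 2) dNG NGv (divr_gt0 g0 (@ltr0Sn R 1)).
pose r := Num.min r1 r2.
pose s := Num.min (Num.min d1 d2) (Num.min d3 (r / (M + 1))) / 2.
have M0 : 0 <= M by rewrite addr_ge0// mulr_ge0// ltW.
have M1 : 0 < M + 1 by rewrite ltr_wpDl.
have r0 : 0 < r by rewrite lt_min r10.
have s20 : 0 < Num.min (Num.min d1 d2) (Num.min d3 (r / (M + 1))).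
  by rewrite !lt_min d10 d20 d30 /= divr_gt0.
have s0 : 0 < s by rewrite divr_gt0.
have : s < Num.min (Num.min d1 d2) (Num.min d3 (r / (M + 1))).
  by rewrite ltr_pdivrMr// mulr_natr mulr2n ltrDl.
rewrite !lt_min => /andP[/andP[sd1 sd2] /andP[sd3 sr]].
have shape (t : R) : (v + s *: Y') + t *: (s *: xi) = v + s *: (Y' + t *: xi).
  by rewrite scalerDr -addrA !scalerA mulrC.
have near (t : R) : - del <= t <= del -> `|(v + s *: Y') + t *: (s *: xi) - v| < r.
  move=> td; rewrite shape [v + _]addrC addrK normrZ gtr0_norm//.
  rewrite (le_lt_trans (ler_wpM2l (ltW s0) (Mle t td)))//.
  rewrite ltr_pdivlMr// in sr; apply: le_lt_trans sr.
  by rewrite ler_pM2l// lerDl.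
have dd : - del <= del by rewrite ge0_cp ?ltW.
(* Since ['d F v Y' = 0], the derivative of [F] along [Y' + t *: xi] has the sign of [t]; hence [F]
   has opposite signs at the two ends. *)
have [||t td Ft] := @line_IVT _ _ F (v + s *: Y') (s *: xi) (- del) del dd.
- by move=> t td; apply: cF; have := near t td; rewrite lt_min => /andP[].
- rewrite !shape nmulr_rle0.
    rewrite ltW// h1 ?s0 ?Mle ?dd ?lexx//.
    by rewrite linearD linearZ/= FY add0r.
  rewrite -oppr_gt0 h2 ?s0 ?Mle ?dd ?lexx//.
  rewrite diffN// fctE linearD linearZ/= FY add0r.
  by rewrite scaleNr opprK.
have := near t td; rewrite lt_min => /andP[_ nt].
have := G0 _ nt Ft; rewrite leNgt => /negP; apply.
rewrite shape -oppr_gt0 h3 ?s0 ?Mle//.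
rewrite diffN// fctE linearD linearZ/= opprD.
have : t * 'd G v xi <= del * `|'d G v xi|.
  rewrite (le_trans (ler_norm _))// normrM ler_wpM2r//.
  by rewrite ler_norml.
have : del * `|'d G v xi| <= g / 2.
  have -> : g / 2 = del * (`|'d G v xi| + 1) by rewrite /del; field; rewrite gt_eqF.
  by rewrite ler_pM2l// lerDl.
by rewrite -/g -[t *: _]/(t * _); lra.
Qed.

(** * Convex sets, their support functions and strict convexity of the cone *)

Definition convex_subset (R : realType) (E : normedModType R) (A : set E) :=
  forall v w, A v -> A w -> forall t : R, 0 <= t <= 1 ->
    A (t *: v + (1 - t) *: w).

Lemma convex_closure (R : realType) (E : normedModType R) (A : set E) :
  convex_subset R E A -> convex_subset R E (closure A).
Proof.
move=> cA v w /closure_dist hv /closure_dist hw t /andP[t0 t1].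
apply/closure_dist => d d0.
have [v' Av vd] := hv d d0; have [w' Aw wd] := hw d d0.
exists (t *: v' + (1 - t) *: w'); first by apply: cA => //; rewrite t0.
rewrite opprD addrACA -!scalerBr (le_lt_trans (ler_normD _ _))//.
rewrite !normrZ !ger0_norm ?subr_ge0//.
have [t00|t00] := ltrP 0 t; last first.
  have -> : t = 0 by apply/le_anti; rewrite t00.
  by rewrite mul0r add0r subr0 mul1r.
have -> : d = t * d + (1 - t) * d by ring.
by apply: ltr_leD; rewrite ?ltr_pM2l ?ler_wpM2l ?subr_ge0// ltW.
Qed.

(** Replace [w] by a point [w'] of [A] and absorb the error by moving [v] by
    [((1 - t) / t) *: (w - w')]. The tolerance [r * t] keeps the moved point in the ball around
    [v]. *)
Lemma convex_interior (R : realType) (E : normedModType R) (A : set E) :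
  open A -> convex_subset R E A -> forall v w, A v -> closure A w ->
  forall t : R, 0 < t <= 1 -> A (t *: v + (1 - t) *: w).
Proof.
move=> oA cA v w Av /closure_dist hw t /andP[t0 t1].
have /nbhs_dist[r r0 hr] : nbhs v A by exact: open_nbhs_nbhs.
have [w' Aw' wd] := hw (r * t) (mulr_gt0 r0 t0).
have -> : t *: v + (1 - t) *: w =
    t *: (v + ((1 - t) / t) *: (w - w')) + (1 - t) *: w'.
  rewrite scalerDr scalerA mulrC divfK ?gt_eqF// scalerBr -addrA; congr (_ + _).
  by rewrite subrK.
apply: cA => //; last by rewrite ltW.
apply: hr; rewrite [v + _]addrC addrK normrZ distrC ger0_norm; last first.
  by rewrite divr_ge0 ?subr_ge0// ltW.
rewrite mulrAC ltr_pdivrMr// (le_lt_trans _ wd)// distrC -[leRHS]mul1r.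
by rewrite ler_wpM2r// gerBl ltW.
Qed.

(* A defining function of the boundary cannot take both signs on A near v: it
   would vanish on a segment of A. *)
Lemma defining_sign (R : realType) (E : normedModType R) (A C : set E)
    (F : E -> R) (v : E) :
  open A -> convex_subset R E A -> C = (closure A `\` interior A) `\ 0 ->
  C v -> (\forall y \near v, {for y, continuous F}) ->
  (\forall y \near v, C y <-> F y = 0) ->
  (\forall y \near v, closure A y -> 0 <= F y) \/
  (\forall y \near v, closure A y -> F y <= 0).
Proof.
move=> oA cA CE Cv /nbhs_dist[r1 r10 cF] /nbhs_dist[r2 r20 CF].
have CA x : A x -> ~ C x.
  by move=> Ax; rewrite CE (iffLR (interior_id A))// => -[[_ +] _]; apply.
have v0 : 0 < `|v|.
  by rewrite normr_gt0; move: Cv; rewrite CE => -[_ /eqP].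
(* The bound by the norm of [v] keeps the ball away from the origin, which is removed from the
   boundary in the description of [C]. *)
pose r := Num.min (Num.min r1 r2) `|v|.
have r0 : 0 < r by rewrite !lt_min r10 r20.
have inA y : `|y - v| < r -> closure A y -> F y != 0 -> A y.
  rewrite !lt_min => /andP[/andP[_ y2] yv] clA Fy.
  apply: contrapT => nA; move/eqP: Fy; apply; apply/CF => //.
  rewrite CE; split; first by split => //; rewrite (iffLR (interior_id A)).
  by move=> y0; move: yv; rewrite y0 sub0r normrN ltxx.
have [pos|] := pselect (forall y, `|y - v| < r -> closure A y -> 0 <= F y).
  by left; apply/nbhs_dist; exists r.
move=> /existsNP[x /not_implyP[xr /not_implyP[clx /negP]]].
rewrite -ltNge => Fx; right; apply/nbhs_dist; exists r => // y yr cly.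
rewrite leNgt; apply/negP => Fy.
have Ax : A x by apply: inA => //; rewrite lt_eqF.
have Ay : A y by apply: inA => //; rewrite gt_eqF.
have seg (t : R) : 0 <= t <= 1 -> `|x + t *: (y - x) - v| < r.
  move=> t01; apply: (@ball_line _ _ _ _ _ _ 0 1) => //.
    by rewrite scale0r addr0.
  by rewrite scale1r [x + _]addrC subrK.
have [||t t01 Ft] := @line_IVT _ _ F x (y - x) 0 1 ler01.
- by move=> t t01; apply: cF; have := seg t t01; rewrite !lt_min -andbA => /andP[].
- by rewrite scale0r addr0 scale1r [x + _]addrC subrK nmulr_rle0// ltW.
apply: (CA (x + t *: (y - x))).
  have -> : x + t *: (y - x) = t *: y + (1 - t) *: x.
    by rewrite scalerBr scalerBl scale1r addrCA.
  exact: cA.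
by apply/CF => //; have := seg t t01; rewrite !lt_min -andbA => /and3P[].
Qed.

Lemma derive_vanish (R : realType) (E E' : normedModType R) (f : E -> E') (v X : E) :
  (\forall t \near (0 : R), f (v + t *: X) = 0) -> 'D_X f v = 0.
Proof.
move=> f0; have fv : f v = 0.
  by have := nbhs_singleton f0; rewrite scale0r addr0.
apply/cvg_lim => //; apply: cvg_near_cst; near=> h.
rewrite /= fv subr0 [_ + v]addrC.
suff -> : f (v + h *: X) = 0 by rewrite scaler0.
near: h; exact: (nbhs_dnbhs f0).
Unshelve. all: by end_near. Qed.

Lemma is_diff_affine (R : realType) (E : normedModType R) (q m : E) (k : R) :
  is_diff m (fun y : E => q + k *: (y - m)) (fun y => k *: y).
Proof.
have -> : (fun y : E => q + k *: (y - m)) = cst q + k *: (id - cst m) by [].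
apply: is_diff_eq; apply/funext => y /=.
by rewrite !fctE /= add0r subr0.
Qed.

Lemma diff_affine_comp (R : realType) (E : normedModType R) (G : E -> R)
    (q m Y : E) (k : R) : differentiable G q ->
  differentiable (fun y => G (q + k *: (y - m))) m /\
  'd (fun y => G (q + k *: (y - m))) m Y = k * 'd G q Y.
Proof.
move=> dG; have h := is_diff_affine R E q m k.
have am : q + k *: (m - m) = q by rewrite subrr scaler0 addr0.
have dG' : differentiable G (q + k *: (m - m)) by rewrite am.
have d1 : differentiable (fun y : E => q + k *: (y - m)) m by exact: ex_diff.
split; first exact: (@differentiable_comp _ _ _ _ (fun y : E => q + k *: (y - m)) G).
rewrite (@diff_comp _ _ _ _ (fun y : E => q + k *: (y - m)) G)// /= am diff_val.
by rewrite linearZ.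
Qed.

(* A convex set contains near [q] a scaled copy of its shape near [m], so a
   support function at [q] has the tangent hyperplane of [F = 0] at [m]. *)
Lemma support_along_segment (R : realType) (E : normedModType R) (A C : set E)
    (F G : E -> R) (m e xi Y : E) (k : R) :
  convex_subset R E (closure A) -> closure A e -> 0 < k <= 1 ->
  (\forall y \near m, {for y, continuous F}) ->
  differentiable F m -> F m = 0 -> 'd F m xi != 0 -> 'd F m Y = 0 ->
  (\forall y \near m, F y = 0 -> closure A y) ->
  let q := k *: m + (1 - k) *: e in
  differentiable G q -> G q = 0 -> (\forall y \near q, closure A y -> 0 <= G y) ->
  'd G q Y = 0.
Proof.
move=> cA cle /andP[k0 k1] cF dF Fm Fxi FY FA q dG Gq G0.
have [d1 d2] := diff_affine_comp R E G q m Y k dG.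
suff : 'd (fun y => G (q + k *: (y - m))) m Y = 0.
  by rewrite d2 => /eqP; rewrite mulf_eq0 gt_eqF//= => /eqP.
(* The homothety of ratio [k] centred at [e] takes [m] to [q] and preserves the closure of [A].
   Composed with it, [G] is nonnegative on the zeros of [F] near [m] and vanishes at [m], so
   Lagrange multipliers apply. *)
apply: (diff_zero_set _ _ F _ m xi) => //; first by rewrite subrr scaler0 addr0.
have ca : {for m, continuous (fun y : E => q + k *: (y - m))}.
  by apply: differentiable_continuous; have h := is_diff_affine R E q m k; exact: ex_diff.
have G1 : \forall y \near m, closure A (q + k *: (y - m)) -> 0 <= G (q + k *: (y - m)).
  suff /ca : nbhs (q + k *: (m - m)) [set z | closure A z -> 0 <= G z] by [].
  by rewrite subrr scaler0 addr0.
near=> y => Fy; have : closure A (q + k *: (y - m)).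
  have -> : q + k *: (y - m) = k *: y + (1 - k) *: e.
    by rewrite /q [LHS]addrC scalerBr addrA subrK.
  have cly : F y = 0 -> closure A y by near: y.
  by apply: cA; [exact: cly| |rewrite ltW].
by near: y.
Unshelve. all: by end_near. Qed.

(* Otherwise the segment from [u] to [w] lies in [C] and the tangent hyperplane
   is constant along it, so [w - u] is in the radical at the midpoint. *)
Lemma strictly_convex_midpoint (R : realType) (E : normedModType R) (C A : set E)
    (u w : E) :
  open A -> convex_subset R E A -> C = (closure A `\` interior A) `\ 0 ->
  (forall v, C v -> forall l : R, 0 < l -> C (l *: v)) ->
  (forall v, C v -> ~ C (- v)) ->
  strongly_convex C A -> C u -> C w ->
  (forall l : R, 0 < l -> w <> l *: u) -> A (2^-1 *: (u + w)).
Proof.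
move=> oA cA CE conic salient sconv Cu Cw indep; apply: contrapT => nAm.
have ccA := convex_closure _ _ _ cA.
have C_spec v : C v <-> [/\ closure A v, ~ A v & v != 0].
  rewrite CE (iffLR (interior_id A))//.
  by split=> [[[? ?] /eqP ?]|[? ? /eqP ?]].
have [clu _ _] := iffLR (C_spec u) Cu.
have [clw _ _] := iffLR (C_spec w) Cw.
have pos_indep (a b : R) : 0 < a -> 0 < b -> a *: u + b *: w != 0.
  move=> a0 b0; apply/eqP => /eqP; rewrite addr_eq0 => /eqP h.
  by apply: (salient _ (conic _ Cw _ b0)); rewrite -h; exact: conic.
pose m := 2^-1 *: (u + w); pose X := w - u.
have mX (t : R) : m + t *: X = (1/2 - t) *: u + (1/2 + t) *: w.
  rewrite !div1r /m /X scalerDr scalerBr !scalerDl scaleNr.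
  by rewrite [t *: w - _]addrC addrACA.
have Cq (t : R) : - (1/2) < t < 1/2 -> C (m + t *: X).
  move=> /andP[t1 t2].
  have a0 : 0 < 1/2 - t by lra.
  have b0 : 0 < 1/2 + t by lra.
  apply/C_spec; split.
  - rewrite mX; have -> : 1 / 2 + t = 1 - (1/2 - t) by lra.
    by apply: ccA => //; lra.
  (* If a point of the open segment were in [A], then [m], lying between it and one of the ends [u],
     [w], would be in [A] as well. *)
  - move=> Aq; apply: nAm; rewrite -/m.
    have [t0|t0] := leP 0 t.
      have k0 : 0 < 1 + 2 * t by lra.
      have -> : m = (1 + 2 * t)^-1 *: (m + t *: X) + (1 - (1 + 2 * t)^-1) *: u.
        rewrite mX /m !scalerDr !scalerA addrAC -scalerDl.
        by congr (_ *: _ + _ *: _); field; rewrite gt_eqF.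
      apply: (convex_interior _ _ _ oA cA) => //.
      by rewrite invr_gt0 k0 invf_le1//; lra.
    have k0 : 0 < 1 - 2 * t by lra.
    have -> : m = (1 - 2 * t)^-1 *: (m + t *: X) + (1 - (1 - 2 * t)^-1) *: w.
      rewrite mX /m !scalerDr !scalerA -addrA -scalerDl.
      by congr (_ *: _ + _ *: _); field; rewrite gt_eqF.
    apply: (convex_interior _ _ _ oA cA) => //.
    by rewrite invr_gt0 k0 invf_le1//; lra.
  - by rewrite mX pos_indep.
have Cm : C m by have := Cq 0; rewrite scale0r addr0; apply; lra.
have near_half : \forall t \near (0 : R), - (1/2) < t < 1/2.
  apply/nbhs_dist; exists (1/2); first by lra.
  by move=> t; rewrite subr0 ltr_norml.
have to_m (P : set E) : nbhs m P -> \forall t \near (0 : R), P (m + t *: X).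
  move=> mP; have /(_ P) := line_continuous _ _ m X 0.
  by rewrite /= scale0r addr0; apply.
have [W [F [xi [[oW Wm smF [z Fz] WF] _ _ _ rad]]]] := sconv m Cm.
have nW : \forall y \near m, W y by exact: open_nbhs_nbhs.
have cF y : W y -> {for y, continuous F} by move=> Wy; exact: (smF 0%N).
have dF y : W y -> differentiable F y by move=> Wy; have [+ _] := smF 1%N; exact.
(* Every defining function of [C] at [m] vanishes along the segment, hence has zero derivative along
   [X]. *)
have tX : tangent_space C m X.
  move=> W' F' [oW' W'm smF' _ W'F'].
  have dF' : differentiable F' m by have [+ _] := smF' 1%N; exact.
  rewrite -deriveE//; apply: derive_vanish.
  have nW' : \forall t \near (0 : R), W' (m + t *: X).
    by apply: to_m; exact: open_nbhs_nbhs.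
  by near=> t; apply/W'F'; [near: t|apply: Cq; near: t].
have ncF : \forall y \near m, {for y, continuous F} by near=> y; apply: cF; near: y.
have nCF : \forall y \near m, C y <-> F y = 0 by near=> y; apply: WF; near: y.
have Fm : F m = 0 by apply/(WF m).
have sgn := defining_sign _ _ _ _ _ _ oA cA CE Cm ncF nCF.
have Fcl : \forall y \near m, F y = 0 -> closure A y.
  by near=> y => Fy; suff /C_spec[] : C y by []; apply/WF => //; near: y.
have dFq Y : tangent_space C m Y ->
    \forall t \near (0 : R), 'd F (m + t *: X) Y = 0.
  move=> tY; have FY : 'd F m Y = 0 by apply: (tY W); split => //; exists z.
  have nWt : \forall t \near (0 : R), W (m + t *: X) by exact: to_m.
  (* The extra point [e] is the end of the segment on the same side of [m], so that [m] keeps a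
     positive weight. *)
  have decomp (t : R) : - (1/2) < t < 1/2 -> exists k e,
      [/\ 0 < k <= 1, closure A e & m + t *: X = k *: m + (1 - k) *: e].
    move=> t12; have [t0|t0] := leP 0 t.
      exists (1 - 2 * t), w; split => //; first by lra.
      rewrite mX /m scalerA scalerDr -addrA -scalerDl.
      by congr (_ *: _ + _ *: _); field.
    exists (1 + 2 * t), u; split => //; first by lra.
    rewrite mX /m scalerA scalerDr addrAC -scalerDl.
    by congr (_ *: _ + _ *: _); field.
  (* According to the sign, [F] or [- F] is a support function at the points of the segment near
     [m]; [nbhs_interior] carries the sign condition to neighbourhoods of those points. *)
  case: sgn => /nbhs_interior sgn.
    have sgnt := to_m _ sgn.
    near=> t.
    have t12 : - (1/2) < t < 1/2 by near: t.
    have [k [e [k01 cle qE]]] := decomp t t12.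
    have Wq : W (m + t *: X) by near: t.
    have Fq : F (m + t *: X) = 0 by apply/WF => //; exact: Cq.
    have nq : \forall y \near (m + t *: X), closure A y -> 0 <= F y by near: t.
    have dq := dF _ Wq.
    rewrite qE in Fq nq dq *.
    exact: (support_along_segment _ _ A C F F m e z Y k ccA cle k01 ncF (dF m Wm) Fm Fz FY Fcl).
  have sgnt := to_m _ sgn.
  near=> t.
  have t12 : - (1/2) < t < 1/2 by near: t.
  have [k [e [k01 cle qE]]] := decomp t t12.
  have Wq : W (m + t *: X) by near: t.
  have NFq : (- F) (m + t *: X) = 0 by rewrite fctE (iffLR (WF _ Wq)) ?oppr0//; exact: Cq.
  have nq : \forall y \near (m + t *: X), closure A y -> 0 <= (- F) y.
    have : \forall y \near (m + t *: X), closure A y -> F y <= 0 by near: t.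
    by apply: filterS => y h /h; rewrite fctE oppr_ge0.
  have dNq : differentiable (- F) (m + t *: X) by apply: differentiableN; exact: dF.
  have : 'd (- F) (m + t *: X) Y = 0.
    rewrite qE in NFq nq dNq *.
    exact: (support_along_segment _ _ A C F (- F) m e z Y k ccA cle k01 ncF (dF m Wm) Fm Fz FY Fcl).
  by rewrite diffN ?fctE; [move/eqP; rewrite oppr_eq0 => /eqP|exact: dF].
(* The function ['D_Y F] vanishes along the segment for each tangent [Y], so [X] lies in the radical
   at [m]. *)
have [l Xl] : exists l : R, X = l *: m.
  apply/(rad X tX) => Y tY; rewrite /second_form (_ : 'D_X _ m = 0) ?oppr0 ?mul0r//.
  apply: derive_vanish; have := dFq Y tY.
  have nWt : \forall t \near (0 : R), W (m + t *: X) by exact: to_m.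
  move=> h; near=> t; rewrite deriveE; first by near: t.
  by apply: dF; near: t.
(* The two coefficients add up to 2, so they are not both negative. Opposite signs contradict
   salience, equal signs contradict [indep], and a zero coefficient would force [u] or [w] to
   vanish. *)
have key : (1 - l / 2) *: w = (1 + l / 2) *: u.
  move: Xl; rewrite /X /m scalerA scalerDr => /eqP.
  rewrite subr_eq addrAC -subr_eq => /eqP h.
  by rewrite scalerBl scale1r h scalerDl scale1r addrC.
have nz v : C v -> v != 0 by move=> /C_spec[].
have [l1|l1|l1] := ltrgtP (1 - l / 2) 0.
- have l2 : 0 < 1 + l / 2 by lra.
  have := pos_indep (1 + l / 2) (- (1 - l / 2)) l2.
  by rewrite oppr_gt0 l1 scaleNr key subrr eqxx => /(_ isT).
- have [l2|l2|l2] := ltrgtP (1 + l / 2) 0.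
  + have := pos_indep (- (1 + l / 2)) (1 - l / 2).
    by rewrite oppr_gt0 l2 l1 scaleNr key addNr eqxx => /(_ isT isT).
  + apply: (indep ((1 + l / 2) / (1 - l / 2))); first exact: divr_gt0.
    by rewrite mulrC -scalerA -key scalerA mulVf ?scale1r// gt_eqF.
  + move: key; rewrite l2 scale0r => /eqP; rewrite scaler_eq0 gt_eqF//=.
    by move/eqP => w0; move: (nz w Cw); rewrite w0 eqxx.
- move: key; rewrite l1 scale0r => /esym/eqP; rewrite scaler_eq0.
  have -> : (1 + l / 2 == 0) = false by apply/negbTE; rewrite gt_eqF//; lra.
  by move=> /= /eqP u0; move: (nz u Cu); rewrite u0 eqxx.
Unshelve. all: by end_near. Qed.

(** * Differentials of local inverses and stability of zeros *)

Lemma diff_near_id (R : realType) (E : normedModType R) (f : E -> E) (x v : E) :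
  differentiable f x -> (\forall y \near x, f y = y) -> 'd f x v = v.
Proof.
move=> df fid; have d1 : differentiable (f - id) x by exact: differentiableB.
apply/eqP; rewrite -subr_eq0.
have -> : 'd f x v - v = 'd (f - id) x v.
  by rewrite diffB ?fctE//; congr (_ - _); rewrite diff_val.
rewrite -deriveE//; apply/eqP; apply: derive_vanish.
suff : \forall t \near (0 : R), f (x + t *: v) = x + t *: v.
  by apply: filterS => t; rewrite !fctE => ->; rewrite subrr.
have /(_ [set y | f y = y]) := line_continuous _ _ x v 0.
by rewrite /= scale0r addr0; apply.
Qed.

Lemma diff_left_inverse (R : realType) (E : normedModType R) (f g : E -> E)
    (x v : E) : differentiable f x -> differentiable g (f x) ->
  (\forall y \near x, g (f y) = y) -> 'd g (f x) ('d f x v) = v.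
Proof.
move=> df dg gf; have -> : 'd g (f x) ('d f x v) = 'd (g \o f) x v.
  rewrite (@diff_comp _ _ _ _ f g)//.
by apply: diff_near_id => //; exact: differentiable_comp.
Qed.

(** The existence half of the implicit function theorem: [F] has strict opposite signs at
    [z - s *: zeta] and [z + s *: zeta], these signs persist for [z'] near [z], and a zero lies in
    between. *)
Lemma zero_near_vertical (R : realType) (E : normedModType R) (F : E -> R)
    (z zeta : E) (W : set E) (del : R) : 0 < del -> nbhs z W ->
  (\forall y \near z, {for y, continuous F}) -> differentiable F z -> F z = 0 ->
  'd F z zeta != 0 ->
  \forall z' \near z, exists t : R,
    [/\ - del <= t <= del, W (z' + t *: zeta) & F (z' + t *: zeta) = 0].
Proof.
move=> del0 nW ncF dF Fz Fzeta.
wlog zeta0 : zeta Fzeta / 0 < 'd F z zeta => [H|].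
  have [?|zn|] := ltrgt0P ('d F z zeta); first exact: H.
    have := H (- zeta); rewrite linearN/= oppr_eq0 oppr_gt0 => /(_ Fzeta zn).
    apply: filterS => z' [t [tdel Wt Ft]]; exists (- t).
    by split; [lra|move: Wt|move: Ft]; rewrite scaleNr scalerN.
  by move=> h; rewrite h eqxx in Fzeta.
have [r r0 hr] := iffLR (nbhs_dist _ _ _ _) (filterI nW ncF).
have dNF : differentiable (- F) z by exact: differentiableN.
have NFz : (- F) z = 0 by rewrite fctE Fz oppr0.
have [d1 d10 h1] := @ray_pos _ _ F z `|zeta| _ dF Fz zeta0.
have [d2 d20 h2] := @ray_pos _ _ _ z `|zeta| _ dNF NFz zeta0.
have N1 : 0 < `|zeta| + 1 by rewrite ltr_wpDl.
pose s := Num.min del (Num.min (Num.min d1 d2) (r / (`|zeta| + 1)) / 2).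
have s20 : 0 < Num.min (Num.min d1 d2) (r / (`|zeta| + 1)).
  by rewrite !lt_min d10 d20 divr_gt0.
have s0 : 0 < s by rewrite lt_min del0 divr_gt0.
have sdel : s <= del by rewrite ge_min lexx.
have : s < Num.min (Num.min d1 d2) (r / (`|zeta| + 1)).
  by rewrite gt_min ltr_pdivrMr// mulr_natr mulr2n ltrDl s20 orbT.
rewrite !lt_min => /andP[/andP[sd1 sd2] sr].
have pos : 0 < F (z + s *: zeta) by apply: h1 => //; rewrite s0.
have neg : F (z + (- s) *: zeta) < 0.
  rewrite -oppr_gt0 scaleNr -scalerN; apply: h2; rewrite ?s0 ?normrN//.
  by rewrite diffN// fctE linearN/= opprK.
have near_r (t : R) : - s <= t <= s -> `|z + t *: zeta - z| < r.
  move=> ts; rewrite [z + _]addrC addrK normrZ.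
  move: sr; rewrite ltr_pdivlMr// => /(le_lt_trans _); apply.
  apply: ler_pM => //; first by rewrite ler_norml.
  by rewrite lerDl.
have ss : - s <= s by lra.
have ctF (t : R) : - s <= t <= s -> {for z + t *: zeta, continuous F}.
  by move=> ts; have [_ +] := hr _ (near_r t ts).
have s_in : - s <= s <= s by rewrite ss lexx.
have ns_in : - s <= - s <= s by rewrite ss lexx.
have n1 : \forall z' \near z, 0 < F (z' + s *: zeta).
  apply: (near_translate _ _ _ _ [set x | 0 < F x]).
  by have /(_ [set a : R | 0 < a]) := ctF s s_in; apply; exact: lt_nbhsr.
have n2 : \forall z' \near z, F (z' + (- s) *: zeta) < 0.
  apply: (near_translate _ _ _ _ [set x | F x < 0]).
  by have /(_ [set a : R | a < 0]) := ctF (- s) ns_in; apply; exact: lt_nbhsl.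
have n3 : \forall z' \near z, `|z' + s *: zeta - z| < r.
  apply: (near_translate _ _ _ _ [set x | `|x - z| < r]); apply/nbhs_dist; exists (r - `|z + s *: zeta - z|).
    by rewrite subr_gt0 near_r// lexx ss.
  move=> y yr /=; rewrite -[y - z](subrKA (z + s *: zeta)) (le_lt_trans (ler_normD _ _))//.
  by rewrite -ltrBrDr.
have n4 : \forall z' \near z, `|z' + (- s) *: zeta - z| < r.
  apply: (near_translate _ _ _ _ [set x | `|x - z| < r]); apply/nbhs_dist; exists (r - `|z + (- s) *: zeta - z|).
    by rewrite subr_gt0 near_r// lexx ss.
  move=> y yr /=; rewrite -[y - z](subrKA (z + (- s) *: zeta)) (le_lt_trans (ler_normD _ _))//.
  by rewrite -ltrBrDr.
near=> z'.
have nr (t : R) : - s <= t <= s -> `|z' + t *: zeta - z| < r.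
  by move=> ts; apply: (@ball_line _ _ _ _ _ _ (- s) s) => //; near: z'.
have [||t ts Ft] := @line_IVT _ _ F z' zeta (- s) s ss.
- by move=> t ts; have [_ +] := hr _ (nr t ts).
- rewrite nmulr_rle0 ?ltW//; first by near: z'.
  by near: z'.
exists t; split => //; last by have [+ _] := hr _ (nr t ts).
by lra.
Unshelve. all: by end_near. Qed.

(** The linear form ['d G u] is nonnegative on [A - u], and a nonzero linear form that is
    nonnegative on an open set is positive there. In the proof, failure at [m] becomes a negative
    value after pushing [m] slightly along [y] inside [A]. *)
Lemma diff_toward_interior (R : realType) (E : normedModType R) (A : set E)
    (G : E -> R) (u m y : E) :
  open A -> convex_subset R E A -> closure A u -> A m ->
  differentiable G u -> G u = 0 -> 'd G u y != 0 ->
  (\forall x \near u, closure A x -> 0 <= G x) -> 0 < 'd G u (m - u).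
Proof.
move=> oA cA clu Am dG Gu Gy pos.
wlog y0 : y Gy / 'd G u y < 0 => [H|].
  have [yp|?|] := ltrgt0P ('d G u y); last by move=> h; rewrite h eqxx in Gy.
    by apply: (H (- y)); rewrite linearN/= ?oppr_eq0// oppr_lt0.
  exact: H Gy _.
rewrite ltNge; apply/negP => mu0.
have /nbhs_dist[r r0 hr] : nbhs m A by exact: open_nbhs_nbhs.
pose eta := r / (`|y| + 1) / 2.
have N1 : 0 < `|y| + 1 by rewrite ltr_wpDl.
have q0 : 0 < r / (`|y| + 1) by exact: divr_gt0.
have eta0 : 0 < eta by exact: divr_gt0.
have etar : eta < r / (`|y| + 1).
  by rewrite ltr_pdivrMr// mulr_natr mulr2n ltrDl.
have Am' : A (m + eta *: y).
  apply: hr; rewrite [m + _]addrC addrK normrZ gtr0_norm//.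
  move: etar; rewrite ltr_pdivlMr// => /(le_lt_trans _); apply.
  by rewrite ler_pM2l// lerDl.
pose Z := m + eta *: y - u.
have GZ : 'd G u Z < 0.
  rewrite /Z addrAC linearD linearZ/=.
  have : eta * 'd G u y < 0 by rewrite pmulr_rlt0.
  by rewrite -[eta *: _]/(eta * _); move: mu0; lra.
have dNG : differentiable (- G) u by exact: differentiableN.
have NGu : (- G) u = 0 by rewrite fctE Gu oppr0.
have c0 : 0 < - 'd G u Z by rewrite oppr_gt0.
have [d d0 h] := @ray_pos _ _ (- G) u `|Z| _ dNG NGu c0.
have pos' : \forall t \near (0 : R), closure A (u + t *: Z) -> 0 <= G (u + t *: Z).
  have /(_ [set x | closure A x -> 0 <= G x]) := line_continuous _ _ u Z 0.
  by rewrite /= scale0r addr0; apply.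
have [e e0 he] := iffLR (nbhs_dist _ _ _ _) pos'.
pose s := Num.min 1 (Num.min d e) / 2.
have s20 : 0 < Num.min 1 (Num.min d e) by rewrite !lt_min ltr01 d0.
have s0 : 0 < s by exact: divr_gt0.
have : s < Num.min 1 (Num.min d e) by rewrite ltr_pdivrMr// mulr_natr mulr2n ltrDl.
rewrite !lt_min => /and3P[s1 sd se].
have : 0 < (- G) (u + s *: Z).
  by apply: h; rewrite ?s0 ?sd// diffN.
rewrite fctE oppr_gt0 ltNge => /negP; apply.
apply: he; first by rewrite subr0 gtr0_norm.
have -> : u + s *: Z = s *: (m + eta *: y) + (1 - s) *: u.
  by rewrite /Z scalerBr scalerBl scale1r addrCA.
apply: convex_closure => //; first exact: subset_closure.
by rewrite !ltW.
Qed.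

(** * Charts, and openness of the timelike vectors in the tangent bundle *)

Section manifold_theory.
Context {R : realType} {n : nat} {M : manifold R n}.
Local Notation V := 'rV[R]_n.+1.
Implicit Types (p q : M) (x y v : V).

Lemma open_dom p : open (dom p).
Proof. by case: M p. Qed.

Lemma dom_self p : dom p p.
Proof. by case: M p. Qed.

Lemma open_chart_dom p : open (chart p @` dom p).
Proof. by case: M p. Qed.

Lemma chartK p q : dom p q -> chart_inv p (chart p q) = q.
Proof. by case: M p q => //. Qed.

Lemma chart_continuous p q : dom p q -> {for q, continuous (chart p)}.
Proof. by case: M p q => //. Qed.

Lemma chart_inv_continuous p y :
  (chart p @` dom p) y -> {for y, continuous (chart_inv p)}.
Proof. by case: M p y => //. Qed.

Lemma transition_smooth p q :
  smooth (chart p @` (dom p `&` dom q)) (chart q \o chart_inv p).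
Proof. by case: M p q => //. Qed.

Lemma chart_inj p q q' : dom p q -> dom p q' -> chart p q = chart p q' -> q = q'.
Proof. by move=> pq pq' e; rewrite -(chartK _ _ pq) e chartK. Qed.

Lemma near_chart_inv p q (U : set M) : dom p q -> nbhs q U ->
  \forall y \near chart p q, [/\ dom p (chart_inv p y),
    U (chart_inv p y) & chart p (chart_inv p y) = y].
Proof.
move=> pq nU; have im : (chart p @` dom p) (chart p q) by exists q.
have n1 : \forall y \near chart p q, (chart p @` dom p) y.
  by apply: open_nbhs_nbhs; split => //; exact: open_chart_dom.
have n2 : \forall y \near chart p q, U (chart_inv p y).
  have /(_ U) := chart_inv_continuous _ _ im.
  by rewrite /= chartK//; apply.
near=> y; have [q' pq' qy] : (chart p @` dom p) y by near: y.
split; last by rewrite -qy chartK.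
  by rewrite -qy chartK.
by near: y.
Unshelve. all: by end_near. Qed.

Lemma transition_differentiable p q r : dom p r -> dom q r ->
  differentiable (chart q \o chart_inv p) (chart p r).
Proof.
by move=> pr qr; have [+ _] := transition_smooth p q 1%N; apply; exists r.
Qed.

Lemma near_chart_chart p q : dom p q ->
  \forall y \near chart q q, (chart q \o chart_inv p) ((chart p \o chart_inv q) y) = y.
Proof.
move=> pq; have nD : nbhs q (dom p).
  by apply: open_nbhs_nbhs; split => //; exact: open_dom.
apply: filterS (near_chart_inv q q _ (dom_self q) nD) => y [_ py yE] /=.
by rewrite (chartK _ _ py).
Qed.

(** Inverts the fibre part of [tchart p] over [q]: vectors at [q], read in the chart at [q], can be
    recovered from their reading in the chart at [p]. *)
Lemma diff_transitionK p q v : dom p q ->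
  'd (chart q \o chart_inv p) (chart p q)
    ('d (chart p \o chart_inv q) (chart q q) v) = v.
Proof.
move=> pq; have qq := dom_self q.
have e : (chart p \o chart_inv q) (chart q q) = chart p q by rewrite /= chartK.
have := diff_left_inverse R _ (chart p \o chart_inv q) (chart q \o chart_inv p) (chart q q) v.
rewrite e; apply; [exact: transition_differentiable..|exact: near_chart_chart].
Qed.

Lemma tchart_self p v : tchart p (p, v) = (chart p p, v).
Proof.
have pp := dom_self p; rewrite /tchart /=; congr (_, _).
apply: diff_near_id; first exact: transition_differentiable.
apply: filterS (near_chart_inv p p _ pp (filterT : nbhs p setT)) => y [] //.
Qed.

Section cone_at.
Context (O : set M) (K : cone M) (hK : cone_structure O K).

(** The set [TC] of [cone_structure]. *)
Definition lightcone_bundle p : set (V * V)%type := tchart p @`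
  [set z | [/\ O z.1, dom p z.1 & lightlike K z.1 z.2]].

Lemma lightcone_bundleP p q y : dom p q -> lightcone_bundle p (chart p q, y) ->
  O q /\ lightlike K q ('d (chart q \o chart_inv p) (chart p q) y).
Proof.
move=> pq [[q' v] [/= Oq pq' Kv]]; rewrite /tchart/= => -[e <-].
rewrite -(chart_inj _ _ _ pq' pq e) in Oq Kv *.
by rewrite diff_transitionK.
Qed.

(** The direction [w - u], a multiple of the vector from [u] to the timelike midpoint, is transverse
    to the cone at [u], so the zeros of a defining function of the bundle persist along it. The
    bound 1/4, less than half the length of the segment in the parameter [t], keeps the point found
    near [u] and the one found near [w] on opposite sides of the midpoint. *)
Lemma lightcone_near_vertical p u w : O p -> lightlike K p u ->
  closure (timelike K p) w -> timelike K p (2^-1 *: (u + w)) ->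
  \forall z \near (chart p p, u), exists t : R,
    - (1/4) <= t <= 1/4 /\ lightcone_bundle p (z.1, z.2 + t *: (w - u)).
Proof.
move=> Op Cu clw Am; have [hyp transv [conic salient] [oA A0 cA CE] sconv] := hK p Op.
have [W [F [oW Wu smF [z Fz] WF]]] := hyp u Cu.
(* Transversality changes any [z] by a vertical vector into a tangent one; starting from
   ['d F z != 0], that vertical vector is not in the kernel. *)
have [y Fy0] : exists y : V, 'd F (chart p p, u) (0, y) != 0.
  have [y ty] := transv u Cu z; exists y.
  have := ty W F; rewrite tchart_self in oW Wu smF Fz WF *.
  move=> /(_ _)/wrap[]; first by split => //; exists z.
  by rewrite linearB/= => /eqP; rewrite subr_eq0 => /eqP <-.
rewrite tchart_self in oW Wu smF Fz WF.
have dF : differentiable F (chart p p, u) by have [+ _] := smF 1%N; exact.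
have nW : nbhs (chart p p, u) W by exact: open_nbhs_nbhs.
have ncF : \forall x \near (chart p p, u), {for x, continuous F}.
  by apply: filterS nW => x; exact: (smF 0%N).
have Fu : F (chart p p, u) = 0.
  by apply/(WF _ Wu); exists (p, u); [split => //; exact: dom_self|exact: tchart_self].
pose inj := fun v : V => (chart p p, v).
have dinj v : is_diff v inj (fun v => (0, v)).
  have -> : inj = (fun v => (cst (chart p p) v, id v)) by [].
  exact: is_diff_eq.
have cinj v : {for v, continuous inj} by apply: differentiable_continuous; exact: ex_diff.
(* Restricted to the fibre, [F] still defines the cone, with nonzero differential at [u] by the
   choice of [y]; so convexity in the single tangent space at [p] applies to it. *)
pose Fp := F \o inj.
have dFp : differentiable Fp u by apply: differentiable_comp => //; exact: ex_diff.
have dFpE v : 'd Fp u v = 'd F (chart p p, u) (0, v).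
  by rewrite (@diff_comp _ _ _ _ inj F)//= diff_val.
have ninj (P : set (V * V)) : nbhs (chart p p, u) P -> \forall v \near u, P (inj v).
  by move=> nP; have /(_ P) := cinj u; apply.
have ncFp : \forall v \near u, {for v, continuous Fp}.
  apply: filterS (ninj _ ncF) => v h; exact: continuous_comp.
have CFp : \forall v \near u, lightlike K p v <-> Fp v = 0.
  apply: filterS (ninj _ nW) => v Wv; rewrite -(WF _ Wv); split.
    by move=> Kv; exists (p, v); [split => //; exact: dom_self|exact: tchart_self].
  by move=> /(lightcone_bundleP _ _ _ (dom_self p))[_]; have [->] := tchart_self p v.
have clu : closure (timelike K p) u by move: Cu; rewrite CE => -[[]].
have Fzeta : 'd F (chart p p, u) (0, w - u) != 0.
  have -> : (0, w - u) = 2 *: (0, 2^-1 *: (u + w) - u) :> V * V.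
    rewrite -[RHS]/(2 *: 0, 2 *: (2^-1 *: (u + w) - u)) scaler0 scalerBr scalerA.
    by rewrite divff// scale1r scaler_nat mulr2n opprD addrACA subrr add0r.
  rewrite linearZ/= scaler_eq0 pnatr_eq0/= -dFpE.
  have Fpy : 'd Fp u y != 0 by rewrite dFpE.
  have [pos|neg] := defining_sign _ _ _ _ _ _ oA cA CE Cu ncFp CFp.
    by rewrite gt_eqF// (diff_toward_interior _ _ _ Fp u _ y oA cA clu Am).
  have dN : differentiable (- Fp) u by exact: differentiableN.
  have : 0 < 'd (- Fp) u (2^-1 *: (u + w) - u).
    apply: (diff_toward_interior _ _ _ (- Fp) u _ y oA cA clu Am) => //.
    - by rewrite fctE -/(inj u) /Fp/= Fu oppr0.
    - by rewrite diffN// fctE oppr_eq0.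
    - by apply: filterS neg => v h /h; rewrite fctE oppr_ge0.
  by rewrite diffN// fctE oppr_gt0 => /lt_eqF ->.
have q0 : 0 < 1/4 :> R by lra.
apply: filterS (zero_near_vertical _ _ F _ _ W _ q0 nW ncF dF Fu Fzeta) => -[x v] [t [t4 Wt Ft]].
exists t; split => //=.
have e : (x, v) + t *: (0, w - u) = (x, v + t *: (w - u)).
  by rewrite -[LHS]/(x + t *: 0, v + t *: (w - u)) scaler0 addr0.
by rewrite e in Wt Ft; apply/(WF _ Wt).
Qed.

(* By transversality the line [y + t *: (w - u)], for [y] near the midpoint,
   meets the cone at [q] near [u] and near [w]; convexity at [q] does the rest. *)
Lemma timelike_near p u w : O p -> lightlike K p u -> lightlike K p w ->
  timelike K p (2^-1 *: (u + w)) ->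
  \forall z \near (chart p p, 2^-1 *: (u + w)), forall q, dom p q ->
    chart p q = z.1 -> timelike K q ('d (chart q \o chart_inv p) (chart p q) z.2).
Proof.
move=> Op Cu Cw Am; set m := 2^-1 *: (u + w).
have [hyp transv [conic salient] [oA A0 cA CE] sconv] := hK p Op.
have clu : closure (timelike K p) u by move: Cu; rewrite CE => -[[]].
have clw : closure (timelike K p) w by move: Cw; rewrite CE => -[[]].
have nu := lightcone_near_vertical p u w Op Cu clw Am.
have nw : \forall z \near (chart p p, w), exists t : R,
    - (1/4) <= t <= 1/4 /\ lightcone_bundle p (z.1, z.2 + t *: (u - w)).
  by apply: lightcone_near_vertical => //; rewrite [w + u]addrC.
have shift (c : V) (P : set (V * V)) : nbhs (chart p p, m + c) P ->
    \forall z \near (chart p p, m), P (z.1, z.2 + c).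
  have e (z : V * V) : z + (0, c) = (z.1, z.2 + c).
    by case: z => x y; rewrite -[LHS]/(x + 0, y + c) addr0.
  move=> nP; have : nbhs ((chart p p, m) + (0, c)) P by rewrite e.
  by move=> /near_translate; apply: filterS => z /=; rewrite e.
have mu : m + (- 2^-1) *: (w - u) = u.
  rewrite /m scalerBr scalerDr !scaleNr opprK addrA addrK -scalerDl.
  by rewrite (_ : 2^-1 + 2^-1 = 1) ?scale1r//; field.
have mw : m + 2^-1 *: (w - u) = w.
  rewrite /m scalerBr scalerDr addrC addrA subrK -scalerDl.
  by rewrite (_ : 2^-1 + 2^-1 = 1) ?scale1r//; field.
rewrite -{1}mu in nu; rewrite -{1}mw in nw.
(* Lightlike vectors are only in the closure of the timelike ones, so convexity first yields the
   closure; the interior is recovered afterwards. *)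
pose P := [set z : V * V | forall q, dom p q -> chart p q = z.1 ->
  O q /\ closure (timelike K q) ('d (chart q \o chart_inv p) (chart p q) z.2)].
have bary (k c1 c2 : R) (y zeta : V) : k * c1 + (1 - k) * c2 = 0 ->
    y = k *: (y + c1 *: zeta) + (1 - k) *: (y + c2 *: zeta).
  move=> h; rewrite !scalerDr !scalerA addrACA -!scalerDl h scale0r addr0.
  by rewrite [k + _]addrC subrK scale1r.
have nP : nbhs (chart p p, m) P.
  near=> z => q pq qz.
  have [t1 [t1b /= B1]] : exists t : R, - (1/4) <= t <= 1/4 /\
    lightcone_bundle p (z.1, z.2 + (- 2^-1) *: (w - u) + t *: (w - u)).
    by near: z; exact: shift nu.
  have [t2 [t2b /= B2]] : exists t : R, - (1/4) <= t <= 1/4 /\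
    lightcone_bundle p (z.1, z.2 + 2^-1 *: (w - u) + t *: (u - w)).
    by near: z; exact: shift nw.
  rewrite -qz in B1 B2.
  have [Oq C1] := lightcone_bundleP _ _ _ pq B1.
  have [_ C2] := lightcone_bundleP _ _ _ pq B2.
  split => //; have [_ _ _ [_ _ cAq CEq] _] := hK q Oq.
  have cl v : lightlike K q v -> closure (timelike K q) v by rewrite CEq => -[[]].
  move: C1 C2 => /cl cl1 /cl cl2.
  (* Measured from [z.2] along [w - u], the two lightlike vectors sit at [- a] and [b]; the weights
     [b / (a + b)] and [a / (a + b)] bring the combination back to 0. *)
  pose a := 2^-1 - t1; pose b := 2^-1 - t2.
  have a0 : 0 < a by rewrite /a; lra.
  have b0 : 0 < b by rewrite /b; lra.
  have ea : - 2^-1 + t1 = - a by rewrite /a opprB addrC.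
  have eb : 2^-1 + - t2 = b by [].
  clearbody a b.
  have ab : 0 < a + b by exact: addr_gt0.
  have -> : z.2 = (b / (a + b)) *: (z.2 + - 2^-1 *: (w - u) + t1 *: (w - u)) +
      (1 - b / (a + b)) *: (z.2 + 2^-1 *: (w - u) + t2 *: (u - w)).
    rewrite -[u - w]opprB scalerN -scaleNr -!addrA -!scalerDl; apply: bary.
    by rewrite ea eb; field; rewrite gt_eqF.
  have : 0 <= b / (a + b) <= 1.
    apply/andP; split; first by apply: divr_ge0; exact: ltW.
    by rewrite ler_pdivrMr// mul1r lerDr ltW.
  move: (b / (a + b)) => k k01.
  by rewrite linearD !linearZ/=; apply: (convex_closure _ _ _ cAq).
(* Near [z] the whole neighbourhood is in [P], so [y] can be pushed slightly away from a timelike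
   vector without leaving the closure. Lying strictly between that timelike vector and a point of
   the closure, it is timelike. *)
apply: filterS (nbhs_interior nP) => z nPz q pq qz.
have [Oq clq] := nbhs_singleton nPz q pq qz.
set S := 'd _ _ in clq *; set y := z.2 in clq *.
have [_ _ _ [oAq _ cAq _] _] := hK q Oq.
(* Only the existence of a timelike vector at [q] is wanted; the radius 1 is arbitrary. *)
have [a Aa _] := iffLR (closure_dist _ _ _ _) clq 1 ltr01.
pose y' := 'd (chart p \o chart_inv q) (chart q q) a.
have Sy' : S y' = a by exact: diff_transitionK.
have nPs : \forall s \near (0 : R), P (z + s *: (0, y - y')).
  have /(_ P) := line_continuous _ _ z (0, y - y') 0.
  by rewrite /= scale0r addr0; apply.
have [d d0 hd] := iffLR (nbhs_dist _ _ _ _) nPs.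
have s0 : 0 < d / 2 by exact: divr_gt0.
have sd : `|d / 2 - 0| < d by rewrite subr0 gtr0_norm// ltr_pdivrMr// mulr_natr mulr2n ltrDl.
have := hd _ sd q pq; move: s0; set s := d / 2 => s0.
rewrite -[(z + _).1]/(z.1 + s *: 0) -[(z + _).2]/(y + s *: (y - y')) scaler0 addr0.
move=> /(_ qz)[_].
rewrite linearD linearZ linearB/= -/S Sy' => cls.
have s1 : 0 < 1 + s by rewrite ltr_wpDl.
have -> : S y = (s / (1 + s)) *: a + (1 - s / (1 + s)) *: (S y + s *: (S y - a)).
  rewrite scalerBr addrA -{2}[S y]scale1r -scalerDl scalerBr !scalerA addrCA -scalerBl.
  rewrite (_ : (1 - s / (1 + s)) * (1 + s) = 1); last by field; rewrite gt_eqF.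
  by rewrite scale1r (_ : s / (1 + s) - _ = 0) ?scale0r ?addr0//; field; rewrite gt_eqF.
apply: convex_interior => //.
by rewrite divr_gt0//= ler_pdivrMr// mul1r lerDr.
Unshelve. all: by end_near. Qed.

End cone_at.
End manifold_theory.

(** * Straight segments of a chart as curves *)

Lemma of_class_subset (R : realType) (E F : normedModType R) (k : nat)
    (U U' : set E) (f : E -> F) : U' `<=` U -> of_class k U f -> of_class k U' f.
Proof.
move=> UU'; elim: k f => [|k IH] f /= => [h x /UU'|[h1 h2]]; first exact: h.
by split=> [x /UU'|v]; [exact: h1|exact/IH/h2].
Qed.

Lemma of_class_line (R : realType) (E F : normedModType R) (k : nat)
    (U : set E) (f : E -> F) (x z : E) : of_class k U f ->
  of_class k [set t : R | U (x + t *: z)] (fun t : R => f (x + t *: z)).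
Proof.
elim: k f => [|k IH] f /= => [h t Ut|[h1 h2]].
  apply: (@continuous_comp _ _ _ (fun t : R => x + t *: z) f).
    exact: line_continuous.
  exact: h.
have dl (t : R) : differentiable (fun t : R => x + t *: z) t.
  by apply: differentiableD => //; apply: differentiableZl.
split=> [t Ut|v].
  by apply: (@differentiable_comp _ _ _ _ (fun t : R => x + t *: z) f) => //; exact: h1.
(* The difference quotients agree before any limit is taken, so this equality of functions holds
   everywhere and feeds the induction. *)
suff -> : 'D_v (fun t : R => f (x + t *: z)) =
    (fun t : R => 'D_(v *: z) f (x + t *: z)).
  exact: (IH ('D_(v *: z) f) (h2 _)).
apply/funext => t; apply: (congr1 (fun G : R -> F => lim (G @ 0^'))).
apply/funext => h /=; congr (_ *: (f _ - _)).
by rewrite scalerDl scalerA addrCA.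
Qed.

Lemma at_right_dnbhs (R : realType) (x : R) : x^'+ `=>` x^'.
Proof.
move=> P; rewrite /dnbhs /at_right /within /=.
by apply: filterS => y h yx; apply: h; rewrite gt_eqF.
Qed.

Lemma at_left_dnbhs (R : realType) (x : R) : x^'- `=>` x^'.
Proof.
move=> P; rewrite /dnbhs /at_left /within /=.
by apply: filterS => y h yx; apply: h; rewrite lt_eqF.
Qed.

Section chart_segments.
Context {R : realType} {n : nat} {M : manifold R n}.
Local Notation V := 'rV[R]_n.+1.

(** The velocity at time [t] is read in the chart at the current point, hence the transition
    differential applied to [X]. The point [q] certifies that the segment stays in the image of the
    chart, where [chart_inv p] is a genuine inverse. *)
Lemma chart_segment_curve (K : M -> set V) (p : M) (x X : V) (c : R) : 0 < c ->
  (forall t, 0 <= t <= c -> exists q, [/\ dom p q, chart p q = x + t *: X &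
     K q ('d (chart q \o chart_inv p) (x + t *: X) X)]) ->
  curve_of_type K (fun t => chart_inv p (x + t *: X)) 0 c.
Proof.
move=> c0 h; pose g t := chart_inv p (x + t *: X).
have gE (t : R) (q : M) : dom p q -> chart p q = x + t *: X -> g t = q.
  by move=> pq e; rewrite /g -e chartK.
have quot (t : R) : 0 <= t <= c ->
    K (g t) ('d (chart (g t) \o chart_inv p) (x + t *: X) X) /\
    h^-1 *: (chart (g t) (g (t + h)) - chart (g t) (g t)) @[h --> (0 : R)^'] -->
      'd (chart (g t) \o chart_inv p) (x + t *: X) X.
  move=> tc; have [q [pq e Kq]] := h t tc.
  rewrite (gE t q pq e); split => //.
  have dq : differentiable (chart q \o chart_inv p) (x + t *: X).
    by rewrite -e; apply: transition_differentiable => //; exact: dom_self.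
  rewrite -deriveE//; have := @diff_derivable _ _ _ _ _ X dq.
  rewrite /derivable /derive => cv; apply: cvg_trans cv; apply: near_eq_cvg.
  near=> r; rewrite /= -/(g t) (gE t q pq e) /g.
  by rewrite scalerDl [x + (_ + r *: X)]addrA [x + t *: X + _]addrC.
split => //.
- exists [:: c]; split => //=; first by rewrite c0.
  case => //= _ t tc; have [q [pq e _]] := h t tc; rewrite -/(g t) (gE t q pq e).
  pose D := chart p @` (dom p `&` dom q).
  have nD : \forall s \near t, D (x + s *: X).
    have nq : nbhs q (dom q) by apply: open_nbhs_nbhs; split; [exact: open_dom|exact: dom_self].
    have /(_ D) := line_continuous _ _ x X t; rewrite /= -e; apply.
    apply: filterS (near_chart_inv p q _ pq nq) => y [py qy yE].
    by exists (chart_inv p y).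
  have [e0 e00 he0] := iffLR (nbhs_ballP _ _) nD.
  exists (fun s : R => (chart q \o chart_inv p) (x + s *: X)), e0; split => //.
    move=> k; apply: of_class_subset (of_class_line _ _ _ k _ _ x X (transition_smooth p q k)).
    exact: he0.
  move=> s _ ts; have [r [pr qr] re] := he0 s ts.
  by rewrite /= -re chartK.
- move=> t /andP[t0 tc]; have t0c : 0 <= t <= c by rewrite t0 ltW.
  have [Kt cv] := quot t t0c; eexists; last exact: Kt.
  exact: cvg_trans (cvg_app _ (at_right_dnbhs R 0)) cv.
- move=> t /andP[t0 tc]; have t0c : 0 <= t <= c by rewrite tc ltW.
  have [Kt cv] := quot t t0c; eexists; last exact: Kt.
  exact: cvg_trans (cvg_app _ (at_left_dnbhs R 0)) cv.
Unshelve. all: by end_near. Qed.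

End chart_segments.

(** * Secants, one-sided velocities and the shortcut *)

Lemma cvg_near (T : topologicalType) (I : Type) (F : set_system I) (Z : I -> T)
    (z : T) (S : set T) : Z e @[e --> F] --> z -> nbhs z S ->
  \forall e \near F, S (Z e).
Proof. by move=> + nS => /(_ _ nS). Qed.

Lemma cvg_norm_bound (R : realType) (E : normedModType R) (Z : R -> E) (z : E)
    (F : set_system R) : Filter F -> Z e @[e --> F] --> z ->
  \forall e \near F, `|Z e| <= `|z| + 1.
Proof.
move=> FF Zz; have nz : nbhs z [set y | `|y - z| < 1] by apply/nbhs_dist; exists 1.
have h : F [set e | `|Z e - z| < 1] by exact: (Zz _ nz).
apply: (filterS _ h) => e /= Ze.
rewrite -[Z e](subrK z) (le_trans (ler_normD _ _))//.
by rewrite addrC lerD2l ltW.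
Qed.

(** Meant for a curve whose secants [Z e] tend to its one-sided velocity [z]: staying on one side of
    [F = 0] gives a weak sign, which non-tangency later makes strict. *)
Lemma diff_ge0_right (R : realType) (E : normedModType R) (F : E -> R) (v z : E)
    (Z : R -> E) : differentiable F v -> F v = 0 ->
  Z e @[e --> (0 : R)^'+] --> z ->
  (\forall e \near (0 : R)^'+, 0 <= F (v + e *: Z e)) -> 0 <= 'd F v z.
Proof.
move=> dF Fv Zz F0; rewrite leNgt; apply/negP => neg.
have c0 : 0 < - 'd F v z / 2 by rewrite divr_gt0// oppr_gt0.
have dNF : differentiable (- F) v by exact: differentiableN.
have NFv : (- F) v = 0 by rewrite fctE Fv oppr0.
have [d d0 h] := @ray_pos _ _ (- F) v (`|z| + 1) _ dNF NFv c0.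
have ncv : \forall e \near (0 : R)^'+, - 'd F v z / 2 <= 'd (- F) v (Z e).
  have cd : {for z, continuous ('d F v)} by exact: diff_continuous.
  have nz : nbhs z [set y | 'd F v y < 'd F v z / 2].
    have /(_ [set a | a < 'd F v z / 2]) := cd; apply.
    by apply: lt_nbhsl; move: neg; lra.
  apply: filterS (cvg_near _ _ _ _ _ _ Zz nz) => e /= he.
  by rewrite diffN// fctE; move: he; lra.
have nb : \forall e \near (0 : R)^'+, `|Z e| <= `|z| + 1 by exact: cvg_norm_bound.
have [e [[e0 ed] he hb Fe]] : exists e, [/\ 0 < e /\ e < d,
    - 'd F v z / 2 <= 'd (- F) v (Z e), `|Z e| <= `|z| + 1 & 0 <= F (v + e *: Z e)].
  apply: (@filter_ex _ (0 : R)^'+ _); near=> e; split.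
  - by split; near: e; [exact: nbhs_right_gt|exact: nbhs_right_lt].
  - by near: e.
  - by near: e.
  - by near: e.
have := h e (Z e); rewrite e0 ed => /(_ isT hb he).
by rewrite fctE oppr_gt0 ltNge Fe.
Unshelve. all: by end_near. Qed.

Lemma near_left_opp (R : realType) (P : set R) :
  (0 : R)^'- P -> \forall e \near (0 : R)^'+, P (- e).
Proof.
rewrite /at_left /at_right /within /= => /nbhs_dist[d d0 h].
apply/nbhs_dist; exists d => // y; rewrite subr0 => yd y0; apply: h.
  by rewrite subr0 normrN.
by rewrite oppr_lt0.
Qed.

Section shortcut.
Context {R : realType} {n : nat} {M : manifold R n}.
Local Notation V := 'rV[R]_n.+1.

(** Lets both halves of the concatenation be followed with one parameter [e > 0]. *)
Lemma left_velocity_right (g : R -> M) (t : R) (X : V) : left_velocity g t X ->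
  e^-1 *: (chart (g t) (g t) - chart (g t) (g (t - e))) @[e --> (0 : R)^'+] --> X.
Proof.
move=> lv P /lv /near_left_opp; apply: filterS => e /=.
by rewrite invrN scaleNr -scalerN opprB.
Qed.

(** [al] and [be] stand for the secants before and after [p]. [K'] is the extension of the cone
    structure past the boundary, needed because [p] itself lies on [eta]; it agrees with [K] on [U],
    where the shortcut runs. *)
Lemma timelike_shortcut (eta U : set M) (O Omega : set M) (K K' : cone M)
    (p : M) (W : set V) (F : V -> R) (u w : V) (al be : R -> V) :
  eta p -> boundary_defining eta U p W F ->
  cone_structure O K' -> O p ->
  (forall q, U q -> timelike K q = timelike K' q) ->
  lightlike K' p u -> lightlike K' p w ->
  'd F (chart p p) u < 0 -> 0 < 'd F (chart p p) w ->
  open Omega -> Omega p ->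
  al e @[e --> (0 : R)^'+] --> u -> be e @[e --> (0 : R)^'+] --> w ->
  \forall e \near (0 : R)^'+, exists (g : R -> M) (c : R),
    [/\ curve_of_type (timelike K) g 0 c,
        g 0 = chart_inv p (chart p p - e *: al e),
        g c = chart_inv p (chart p p + e *: be e) &
        forall t, 0 <= t <= c -> U (g t) /\ Omega (g t)].
Proof.
move=> eta_p [[oW Wp smF _ WF] WU] hK Op KK' Cu Cw Fu Fw oOm Omp alu bew.
set x0 := chart p p in oW Wp smF WF WU Fu Fw *.
have pp := dom_self p.
have dF : differentiable F x0 by have [+ _] := smF 1%N; exact.
have Fx0 : F x0 = 0 by apply/(WF _ Wp); exists p.
have [_ _ [conic salient] [oA A0 cA CE] sconv] := hK p Op.
have indep (l : R) : 0 < l -> w <> l *: u.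
  move=> l0 wl; move: Fw; rewrite wl linearZ/= ltNge => /negP; apply.
  by rewrite -[l *: _]/(l * _) pmulr_rle0// ltW.
have Am := strictly_convex_midpoint _ _ _ _ _ _ oA cA CE conic salient sconv Cu Cw indep.
have [r r0 hr] := iffLR (nbhs_dist _ _ _ _) (timelike_near _ _ hK _ _ _ Op Cu Cw Am).
have nOm : nbhs p Omega by exact: open_nbhs_nbhs.
have nN : \forall x \near x0, [/\ dom p (chart_inv p x), Omega (chart_inv p x),
    chart p (chart_inv p x) = x & W x].
  have nW : nbhs x0 W by exact: open_nbhs_nbhs.
  by apply: filterS2 nW (near_chart_inv p p _ pp nOm) => x ? [].
have [r' r'0 hN] := iffLR (nbhs_dist _ _ _ _) nN.
pose M0 := (`|u| + 1) + (`|w| + 1).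
(* Half of the limiting slopes, so that for small [e] both [- al e] and [be e] point into [U] with
   slope at least [c]. *)
pose c := Num.min (- 'd F x0 u / 2) ('d F x0 w / 2).
have c0 : 0 < c by rewrite lt_min; apply/andP; split; lra.
have [d d0 hF] := @ray_pos _ _ F x0 M0 c dF Fx0 c0.
have M00 : 0 < M0 by rewrite /M0 addr_gt0// ltr_wpDl.
have M01 : 0 < M0 + 1 by rewrite addr_gt0.
have cd z : {for z, continuous ('d F x0)} by exact: diff_continuous.
have nal : \forall e \near (0 : R)^'+, c <= - 'd F x0 (al e).
  have nz : nbhs u [set y | 'd F x0 y < 'd F x0 u / 2].
    have /(_ [set a | a < 'd F x0 u / 2]) := cd u; apply.
    by apply: lt_nbhsl; lra.
  apply: filterS (cvg_near _ _ _ _ _ _ alu nz) => e /= he.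
  by rewrite ge_min; apply/orP; left; lra.
have nbe : \forall e \near (0 : R)^'+, c <= 'd F x0 (be e).
  have nz : nbhs w [set y | 'd F x0 w / 2 < 'd F x0 y].
    have /(_ [set a | 'd F x0 w / 2 < a]) := cd w; apply.
    by apply: lt_nbhsr; lra.
  apply: filterS (cvg_near _ _ _ _ _ _ bew nz) => e /= he.
  by rewrite ge_min; apply/orP; right; lra.
have nbal : \forall e \near (0 : R)^'+, `|al e| <= `|u| + 1 by exact: cvg_norm_bound.
have nbbe : \forall e \near (0 : R)^'+, `|be e| <= `|w| + 1 by exact: cvg_norm_bound.
have nX : \forall e \near (0 : R)^'+, `|2^-1 *: (al e + be e) - 2^-1 *: (u + w)| < r.
  have : 2^-1 *: (al e + be e) @[e --> (0 : R)^'+] --> 2^-1 *: (u + w).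
    by apply: cvgZl_tmp; exact: cvgD.
  have nr : nbhs (2^-1 *: (u + w)) [set y | `|y - 2^-1 *: (u + w)| < r].
    by apply/nbhs_dist; exists r.
  by move=> /cvg_near /(_ nr).
near=> e.
have e0 : 0 < e by near: e; exact: nbhs_right_gt.
have ed : e < d by near: e; exact: nbhs_right_lt.
have er : e < r / (M0 + 1) by near: e; apply: nbhs_right_lt; rewrite divr_gt0.
have er' : e < r' / (M0 + 1) by near: e; apply: nbhs_right_lt; rewrite divr_gt0.
have ale : `|al e| <= `|u| + 1 by near: e.
have bee : `|be e| <= `|w| + 1 by near: e.
have Fal : c <= - 'd F x0 (al e) by near: e.
have Fbe : c <= 'd F x0 (be e) by near: e.
have Xr : `|2^-1 *: (al e + be e) - 2^-1 *: (u + w)| < r by near: e.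
pose X := 2^-1 *: (al e + be e); pose y0 := x0 - e *: al e.
(* Seen from [x0], the shortcut at time [t] is [e *: Z t], with [Z t] between [- al e] and [be e].
   Bounds on the norm and on the slope at these two ends thus hold along the whole segment. *)
pose Z (t : R) := (1 - t / (2 * e)) *: (- al e) + (t / (2 * e)) *: be e.
have yZ (t : R) : y0 + t *: X = x0 + e *: Z t.
  rewrite /y0 /X /Z -addrA; congr (_ + _).
  rewrite [RHS]scalerDr !scalerA scalerDr addrA scalerN -[- (e *: _)]scaleNr -[- ((e * _) *: _)]scaleNr -scalerDl.
  by congr (_ *: _ + _ *: _); field; rewrite gt_eqF.
have t01 (t : R) : 0 <= t <= 2 * e -> 0 <= t / (2 * e) <= 1.
  move=> /andP[t0 te]; apply/andP; split.
    by apply: divr_ge0 => //; apply: mulr_ge0 => //; exact: ltW.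
  by rewrite ler_pdivrMr ?mul1r// mulr_gt0.
have ZM (t : R) : 0 <= t <= 2 * e -> `|Z t| <= M0.
  move=> /t01; rewrite /Z; move: (t / (2 * e)) => k /andP[k0 k1].
  rewrite (le_trans (ler_normD _ _))// !normrZ normrN.
  rewrite !ger0_norm ?subr_ge0//; apply: lerD.
    by rewrite (le_trans _ ale)// ler_piMl// gerBl.
  by rewrite (le_trans _ bee)// ler_piMl.
have ZF (t : R) : 0 <= t <= 2 * e -> c <= 'd F x0 (Z t).
  move=> /t01; rewrite /Z; move: (t / (2 * e)) => k /andP[k0 k1].
  rewrite linearD !linearZ/= linearN/=.
  rewrite -[(1 - k) *: _]/((1 - k) * _) -[k *: _]/(k * _).
  have : (1 - k) * c <= (1 - k) * - 'd F x0 (al e) by rewrite ler_wpM2l// subr_ge0.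
  have : k * c <= k * 'd F x0 (be e) by rewrite ler_wpM2l.
  lra.
have small (rho t : R) : e < rho / (M0 + 1) -> 0 <= t <= 2 * e ->
    `|y0 + t *: X - x0| < rho.
  rewrite ltr_pdivlMr// => erho te.
  rewrite yZ [x0 + _]addrC addrK normrZ gtr0_norm//.
  apply: le_lt_trans erho; rewrite ler_pM2l//.
  by rewrite (le_trans (ZM _ te))// lerDl.
have inU (t : R) : 0 <= t <= 2 * e -> let q := chart_inv p (y0 + t *: X) in
    [/\ dom p q, Omega q, chart p q = y0 + t *: X & U q].
  move=> te q; have [pq Omq qE Wq] := hN _ (small r' t er' te); split => //.
  have : 0 < F (y0 + t *: X) by rewrite yZ; apply: hF; rewrite ?e0 ?ed ?ZM ?ZF.
  move=> /(iffRL (WU _ Wq))[q' [Uq' pq'] q'E].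
  by rewrite /q -q'E chartK.
exists (fun t => chart_inv p (y0 + t *: X)), (2 * e); split.
- apply: chart_segment_curve; first by rewrite mulr_gt0.
  move=> t te; have := inU t te; move: (chart_inv p _) => q /= [pq _ qE Uq].
  exists q; split => //; rewrite KK'//.
  have := hr (y0 + t *: X, X); rewrite prod_normE/= gt_max => /(_ _ q pq qE).
  rewrite qE; apply; apply/andP; split; last exact: Xr.
  exact: small.
- by rewrite scale0r addr0.
- congr chart_inv; rewrite yZ /Z divff ?mulf_neq0 ?gt_eqF// subrr scale0r add0r.
  by rewrite scale1r.
- by move=> t te; have [_ ? _ ?] := inU t te.
Unshelve. all: by end_near. Qed.

End shortcut.

(** * The boundary hypersurface and the conclusion *)

Lemma not_tangent_diff (R : realType) (n : nat) (M : manifold R n)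
    (eta U : set M) (p : M) (W : set 'rV[R]_n.+1) (F : 'rV[R]_n.+1 -> R)
    (v : 'rV[R]_n.+1) :
  eta p -> boundary_defining eta U p W F -> ~ tangent_at eta p v ->
  'd F (chart p p) v != 0.
Proof.
move=> eta_p [[oW Wp smF [xi Fxi] WF] _] ntan; apply/eqP => Fv.
apply: ntan => W' F' [oW' W'p smF' _ WF'].
have ip : in_chart p eta (chart p p) by exists p; [split => //; exact: dom_self|].
have nW : \forall y \near chart p p, W y by exact: open_nbhs_nbhs.
have nW' : \forall y \near chart p p, W' y by exact: open_nbhs_nbhs.
(* Tangency quantifies over all defining functions; two of them have the same zeros near the point,
   so a vector killed by one differential is killed by the other. *)
apply: (diff_zero_set _ _ F F' (chart p p) xi) => //.
- by apply: filterS nW => y; exact: (smF 0%N).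
- by have [+ _] := smF 1%N; exact.
- exact/(WF _ Wp).
- by have [+ _] := smF' 1%N; exact.
- exact/(WF' _ W'p).
- by apply: filterS2 nW nW' => y Wy W'y /(WF _ Wy)/(WF' _ W'y) ->.
Qed.

Lemma closure_side (R : realType) (n : nat) (M : manifold R n) (eta : set M)
    (Qs : side -> set M) (q : M) : divides eta Qs ->
  closure (Qs side1) q -> ~ eta q -> Qs side1 q.
Proof.
move=> [_ oQ disj cover _] clq neta.
have : (Qs side1 `|` Qs side2) q by rewrite cover.
case=> // Q2q; have nq : nbhs q (Qs side2) by exact: open_nbhs_nbhs.
have [x xx] := clq _ nq.
by have : (Qs side1 `&` Qs side2) x by []; rewrite disj.
Qed.

Theorem corollary6p8 (R : realType) (n : nat) (hn : (2 <= n)%N)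
    (Q : manifold R n) (eta : set Q) (Qs : side -> set Q)
    (hQ : divides eta Qs)
    (Cs : side -> cone Q)
    (hC : forall mu, cone_structure_on_closure (Qs mu) (Cs mu))
    (a tau b : R) (gu gw : R -> Q) (u w : 'rV[R]_n.+1)
    (hu : incident_trajectory eta Qs Cs a tau gu u)
    (hw : reflected_trajectory eta Qs Cs tau b gu u gw w)
    (htr : transverse eta (concatenation tau gu gw) a b) :
  ~ snell_cone_geodesic eta Qs Cs (concatenation tau gu gw) a b.
Proof.
case: hu hw => [at_ [clu _] [utr eta_p] velu [Cu _]].
case=> [tb [clw _] [wtr gwu] velw [Cw _ _]] [cg /(_ tau) snell].
set g := concatenation tau gu gw in htr cg snell *; set p := gu tau in eta_p Cu gwu *.
have gp : g tau = p by rewrite /g /concatenation lexx.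
have tab : a <= tau <= b by rewrite !ltW.
have gl (e : R) : 0 < e -> g (tau - e) = gu (tau - e).
  by move=> e0; rewrite /g /concatenation gerBl ltW.
have gr (e : R) : 0 < e -> g (tau + e) = gw (tau + e).
  by move=> e0; rewrite /g /concatenation gerDl leNgt e0.
pose x0 := chart p p.
pose al (e : R) := e^-1 *: (x0 - chart p (g (tau - e))).
pose be (e : R) := e^-1 *: (chart p (g (tau + e)) - x0).
have alu : al e @[e --> (0 : R)^'+] --> u.
  apply: cvg_trans (left_velocity_right _ _ _ velu); apply: near_eq_cvg.
  by near=> e; rewrite /al gl//; near: e; exact: nbhs_right_gt.
have bew : be e @[e --> (0 : R)^'+] --> w.
  apply: cvg_trans velw; apply: near_eq_cvg; rewrite gwu.
  by near=> e; rewrite /be gr//; near: e; exact: nbhs_right_gt.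
have [_ trv] := htr.
have etag : eta (g tau) by rewrite gp.
have [trl trr] := trv tau tab etag.
(* [transverse] only provides some non-tangent left velocity; uniqueness of limits identifies it
   with [u]. *)
have ntan_u : ~ tangent_at eta p u.
  have [X velX ntX] := trl at_; rewrite gp in ntX.
  suff -> : u = X by [].
  have := left_velocity_right _ _ _ velX; rewrite gp => alX.
  exact: (cvg_unique _ alu alX).
have ntw : ~ tangent_at eta p w.
  have [X velX ntX] := trr tb; rewrite gp in ntX.
  suff -> : w = X by [].
  rewrite /right_velocity gp in velX.
  exact: (cvg_unique _ bew velX).
have [_ _ _ _ bdry] := hQ.
have [W [F WF]] := bdry side1 p eta_p.
have Fu := not_tangent_diff _ _ _ _ _ _ _ _ _ eta_p WF ntan_u.
have Fw := not_tangent_diff _ _ _ _ _ _ _ _ _ eta_p WF ntw.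
have clp : closure (Qs side1) p by apply: clu; rewrite lexx ltW.
have [D [K' [oD clD hK KK']]] := hC side1.
have [Kp _] := KK' p clp.
rewrite Kp in Cu; rewrite gwu Kp in Cw.
have pp := dom_self p.
have ng (t : R -> R) (P : set Q) : (forall e, `|t e - tau| = `|e|) -> nbhs p P ->
    \forall e \near (0 : R)^'+, P (g (t e)).
  move=> ht nP; have nP' : nbhs (g tau) P by rewrite gp.
  (* On the open interval, continuity within the set is ordinary continuity, and [tau] is an
     interior point. *)
  have cgo : {within `]a, b[, continuous g}.
    apply: continuous_subspaceW cg => x /=; rewrite !in_itv /= => /andP[? ?].
    by rewrite !ltW.
  rewrite continuous_open_subspace in cgo; last exact: interval_open.
  have /cgo cgt : tau \in `]a, b[%classic by rewrite inE /= in_itv /= at_ tb.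
  have [d d0 hd] := iffLR (nbhs_dist _ _ _ _) (cgt _ nP').
  near=> e; apply: hd; rewrite ht gtr0_norm; near: e; [exact: nbhs_right_lt|exact: nbhs_right_gt].
have nleft (P : set Q) : nbhs p P -> \forall e \near (0 : R)^'+, P (g (tau - e)).
  by apply: ng => e; rewrite addrC addKr normrN.
have nright (P : set Q) : nbhs p P -> \forall e \near (0 : R)^'+, P (g (tau + e)).
  by apply: ng => e; rewrite addrC addKr.
have smalla : \forall e \near (0 : R)^'+, a <= tau - e.
  by near=> e; rewrite lerBrDr -lerBrDl; near: e; apply: nbhs_right_le; rewrite subr_gt0.
have smallb : \forall e \near (0 : R)^'+, tau + e <= b.
  by near=> e; rewrite -lerBrDl; near: e; apply: nbhs_right_le; rewrite subr_gt0.
have pos : \forall e \near (0 : R)^'+, 0 < e by exact: nbhs_right_gt.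
(* The incident trajectory meets [eta] only at [tau], so its earlier points of the closure are in
   the open side. *)
have sidel : \forall e \near (0 : R)^'+, Qs side1 (g (tau - e)).
  near=> e; have e0 : 0 < e by near: e.
  have ae : a <= tau - e by near: e.
  have te : a <= tau - e <= tau by rewrite ae gerBl ltW.
  rewrite gl//; apply: (closure_side _ _ _ eta) => //; first exact: clu.
  case: utr => t [_ uniq] etae.
  have t1 := uniq (tau - e) (conj te etae).
  have tt : a <= tau <= tau by rewrite lexx ltW.
  have t2 := uniq tau (conj tt eta_p).
  by move: e0; rewrite -(subKr tau e) -t1 t2 subrr ltxx.
have sider : \forall e \near (0 : R)^'+, Qs side1 (g (tau + e)).
  near=> e; have e0 : 0 < e by near: e.
  have eb : tau + e <= b by near: e.
  have te : tau <= tau + e <= b by rewrite eb lerDl ltW.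
  rewrite gr//; apply: (closure_side _ _ _ eta) => //; first exact: clw.
  case: wtr => t [_ uniq] etae.
  have t1 := uniq (tau + e) (conj te etae).
  have tt : tau <= tau <= b by rewrite lexx ltW.
  have t2 : t = tau by apply: uniq; split => //; rewrite gwu.
  by move: e0; rewrite -[e](addKr tau) -t1 t2 addNr ltxx.
have ale (e : R) : 0 < e -> x0 - e *: al e = chart p (g (tau - e)).
  by move=> e0; rewrite /al scalerA divff ?gt_eqF// scale1r opprB addrC subrK.
have bee (e : R) : 0 < e -> x0 + e *: be e = chart p (g (tau + e)).
  by move=> e0; rewrite /be scalerA divff ?gt_eqF// scale1r addrC subrK.
have [[oW Wp smF _ WF0] WU] := WF.
have dF : differentiable F x0 by have [+ _] := smF 1%N; exact.
have Fx0 : F x0 = 0 by apply/(WF0 _ Wp); exists p.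
have nWp : nbhs p [set q | dom p q /\ W (chart p q)].
  apply: filterI; first by apply: open_nbhs_nbhs; split => //; exact: open_dom.
  by apply: (chart_continuous _ _ pp); exact: open_nbhs_nbhs.
(* The secants coming from the first side give the weak inequality, and [Fu] excludes equality. *)
have Fu0 : 'd F x0 u < 0.
  rewrite lt_neqAle Fu -oppr_ge0 -linearN /=.
  apply: (@diff_ge0_right _ _ F x0 (- u) (fun e => - al e)) => //; first exact: cvgN.
  have nWl := nleft _ nWp.
  near=> e; rewrite scalerN ale; last by near: e.
  have [pq Wq] : dom p (g (tau - e)) /\ W (chart p (g (tau - e))) by near: e.
  apply/ltW/(WU _ Wq); exists (g (tau - e)) => //; split => //.
  by near: e.
have Fw0 : 0 < 'd F x0 w.
  rewrite lt_neqAle eq_sym Fw.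
  apply: (@diff_ge0_right _ _ F x0 w be) => //.
  have nWr := nright _ nWp.
  near=> e; rewrite bee; last by near: e.
  have [pq Wq] : dom p (g (tau + e)) /\ W (chart p (g (tau + e))) by near: e.
  apply/ltW/(WU _ Wq); exists (g (tau + e)) => //; split => //.
  by near: e.
have [N [e0 /= [oN Np e00 inN hor]]] := snell tab; rewrite gp in Np.
have KU q : Qs side1 q -> timelike (Cs side1) q = timelike K' q.
  by move=> Uq; have [] := KK' q (subset_closure Uq).
have short := timelike_shortcut _ _ _ N _ _ _ _ _ _ _ al be eta_p WF hK (clD _ clp) KU
  Cu Cw Fu0 Fw0 oN Np alu bew.
have nD : nbhs p (dom p) by apply: open_nbhs_nbhs; split => //; exact: open_dom.
have nDl := nleft _ nD; have nDr := nright _ nD.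
have : \forall e \near (0 : R)^'+, False; last by move=> /filter_ex[].
near=> e.
have ep : 0 < e by near: e.
have ee0 : e <= e0 by near: e; exact: nbhs_right_le.
have ae : a <= tau - e by near: e.
have eb : tau + e <= b by near: e.
have [h [c [hcurve h0 hc hin]]] : exists (h : R -> Q) (c : R),
    [/\ curve_of_type (timelike (Cs side1)) h 0 c,
        h 0 = chart_inv p (x0 - e *: al e), h c = chart_inv p (x0 + e *: be e) &
        forall t, 0 <= t <= c -> Qs side1 (h t) /\ N (h t)] by near: e.
have dl : dom p (g (tau - e)) by near: e.
have dr : dom p (g (tau + e)) by near: e.
rewrite ale// chartK// in h0; rewrite bee// chartK// in hc.
have I1 : a <= tau - e <= b /\ tau - e0 <= tau - e <= tau + e0 by split; lra.
have I2 : a <= tau + e <= b /\ tau - e0 <= tau + e <= tau + e0 by split; lra.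
have neq : tau - e != tau + e by rewrite lt_eqF//; lra.
have lt_e : tau - e < tau + e by lra.
have [_ nreach] := iffLR (hor _ _ I1 I2 neq) lt_e.
apply: nreach; exists h, 0, c; split => //; last by move=> t /hin[].
(* The shortcut lies in the open side and never meets [eta], so it falls under the first kind of
   extended curve and the crossing condition is vacuous. *)
left; exists side1; split.
  by split => // t /hin[Qt _]; exact: subset_closure.
move=> s t /hin[Qs1 _] _ etas _.
have [_ _ _ cover _] := hQ.
by have : (~` eta) (h s) by rewrite -cover; left.
Unshelve. all: by end_near. Qed.
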